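(* Let $\Gamma$ be a nonelementary hyperbolic group, $\mu$ a finitely supported nondegenerate probability measure on $\Gamma$, and $K$ the Martin kernel of the associated random walk. There exist $0\le\tau<1$ and, for any $g\in\Gamma$, a constant $H_g\ge0$ such that for all $\xi,\eta\in\partial\Gamma$, $$|K(g,\xi)-K(g,\eta)|\le H_g\tau^{(\xi|\eta)}.$$
   Context: Nonelementary means that $\Gamma$ has no cyclic subgroup of finite index; nondegenerate means that the semigroup generated by the support of $\mu$ is $\Gamma$. Fix a finite symmetric generating set $S$ of $\Gamma$ containing the support of $\mu$; $|g|$ is the word length and $d(x,y)=|x^{-1}y|$. The Gromov product is $(x|y)=\frac12(|x|+|y|-d(x,y))$ on $\Gamma$, and for $\xi,\eta$ in the Gromov boundary $\partial\Gamma$, $(\xi|\eta)=\sup\liminf_{i,j\to\infty}(x_i|y_j)$ over all sequences $x_i\to\xi$, $y_j\to\eta$ in $\Gamma$ (so $(\xi|\xi)=\infty$, with $\tau^\infty=0$). Random walk: $p(x,y)=\mu(x^{-1}y)$ with $n$-step probabilities $p^{(n)}(x,y)$, Green function $G(x,y)=\sum_{n\ge0}p^{(n)}(x,y)<\infty$, Martin kernel $K(x,y)=G(x,y)/G(e,y)$ for $x,y\in\Gamma$, where $e$ is the unit. By a theorem of Ancona the Martin boundary equals $\partial\Gamma$, so $K(x,\xi)=\lim_{y\to\xi}K(x,y)$ exists for $\xi\in\partial\Gamma$ and is continuous in $\xi$. *)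

(* Defs.v *)
From HB Require Import structures.
From mathcomp Require Import all_boot all_order all_algebra.
From mathcomp Require Import all_classical all_reals all_analysis.

Set Implicit Arguments.
Unset Strict Implicit.
Unset Printing Implicit Defensive.

Import Order.TTheory GRing.Theory Num.Theory.
Import numFieldNormedType.Exports.

Local Open Scope classical_set_scope.
Local Open Scope ring_scope.

Section Groups.
Variable Gamma : groupType.
Implicit Types (S H : set Gamma) (g h x y : Gamma).

Definition subsemigroup H : Prop := forall x y, H x -> H y -> H (x * y)%g.

Definition subgroup H : Prop :=
  [/\ H 1%g, subsemigroup H & forall x, H x -> H (x^-1)%g].

(* For a word metric S must also be symmetric, so that words in S alone reach
   every element of Gamma. *)
Definition symmetric_generating_set S : Prop :=
  [/\ finite_set S, forall s, S s -> S (s^-1)%g &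
      smallest subgroup S = [set: Gamma]].

Definition cyclic_subgroup g : set Gamma := smallest subgroup [set g].

Definition finite_index H : Prop :=
  finite_set (range (fun x => [set (x * h)%g | h in H])).

Definition nonelementary : Prop :=
  ~ exists g, finite_index (cyclic_subgroup g).

Definition is_word_of_length S g (n : nat) : Prop :=
  exists w : seq Gamma,
    [/\ size w = n, forall s, s \in w -> S s & (\prod_(s <- w) s)%g = g].

(* The junk value is never used when S is a symmetric generating set. *)
Definition word_length S g : nat :=
  get [set n | is_word_of_length S g n /\
               forall m, is_word_of_length S g m -> (n <= m)%N].

Definition word_dist S x y : nat := word_length S (x^-1 * y)%g.

End Groups.

Section Boundary.
Variables (R : realType) (Gamma : groupType) (S : set Gamma).
Implicit Types (x y : Gamma) (u v : nat -> Gamma).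

Definition gromov_product x y : R :=
  ((word_length S x)%:R + (word_length S y)%:R - (word_dist S x y)%:R) / 2.

Definition gromov_hyperbolic : Prop :=
  exists2 delta : R, 0 <= delta &
    forall x y z,
      Num.min (gromov_product x z) (gromov_product z y) - delta
        <= gromov_product x y.

(* (u_i | v_j) --> +oo as i, j --> oo independently *)
Definition gromov_equiv u v : Prop :=
  gromov_product (u ij.1) (v ij.2) @[ij --> filter_prod \oo \oo] --> +oo.

Definition converges_at_infinity u : Prop := gromov_equiv u u.

(* A boundary point is an equivalence class of sequences converging at
   infinity (gromov_equiv is transitive on them when Gamma is hyperbolic). *)
Record gromov_boundary := GromovBoundary {
  boundary_class : set (nat -> Gamma) ;
  boundary_classP : exists2 u, converges_at_infinity u &
    boundary_class = [set v | converges_at_infinity v /\ gromov_equiv u v] }.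

Definition converges_to u (xi : gromov_boundary) : Prop := boundary_class xi u.

(* (xi | eta) is the supremum of liminf_(i, j) (u_i | v_j) over u --> xi and
   v --> eta. *)
Definition boundary_product (xi eta : gromov_boundary) : \bar R :=
  ereal_sup [set limf_einf (fun ij : nat * nat =>
                    (gromov_product (uv.1 ij.1) (uv.2 ij.2))%:E)
                  (filter_prod \oo \oo)
            | uv in boundary_class xi `*` boundary_class eta].

(* The filter "y --> xi, y in Gamma": the intersection of the filters of all
   the sequences in Gamma that converge to xi. *)
Definition toward (xi : gromov_boundary) : set_system Gamma :=
  [set A | forall u, converges_to u xi -> \forall n \near \oo, A (u n)].

End Boundary.

(* Hyperbolicity of a group does not depend on the choice of the finite
   generating set. *)
Definition hyperbolic_group (R : realType) (Gamma : groupType) : Prop :=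
  exists2 S : set Gamma, symmetric_generating_set S & gromov_hyperbolic R S.

Section RandomWalk.
Variables (R : realType) (Gamma : groupType) (mu : Gamma -> R).
Implicit Types x y : Gamma.

Definition walk_support : set Gamma := [set g | mu g != 0].

Definition finitely_supported_probability : Prop :=
  [/\ forall g, 0 <= mu g, finite_set walk_support & \sum_(g \in setT) mu g = 1].

Definition nondegenerate_walk : Prop :=
  smallest (@subsemigroup Gamma) walk_support = [set: Gamma].

Definition transition x y : R := mu (x^-1 * y)%g.

(* The sum over z has finite support when mu has. *)
Fixpoint nstep (n : nat) x y : R :=
  if n is n'.+1 then \sum_(z \in setT) transition x z * nstep n' z y
  else (x == y)%:R.

Definition green x y : \bar R := (\sum_(0 <= n <oo) (nstep n x y)%:E)%E.

Definition martin x y : R := fine (green x y) / fine (green 1%g y).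

(* For a nondegenerate finitely supported mu on a nonelementary hyperbolic group
   the limit exists and green is finite (Ancona). *)
Definition boundary_martin (S : set Gamma) x (xi : gromov_boundary R S) : R :=
  lim (martin x y @[y --> toward xi]).

End RandomWalk.

(* tau ^ r for an exponent r in [0, +oo], with tau ^ +oo = 0. *)
Definition power_ereal (R : realType) (tau : R) (r : \bar R) : R :=
  if r is r'%:E then tau `^ r' else 0.

(* Main.v *)
(* Everything is done in a word metric d for which the group is hyperbolic, with
   base point e; G is the Green function, p the transition probabilities.

   Spectral gap.  If the group were not branching uniformly (from every point,
   many geodesics of some length L pointing away from e), its balls would be
   uniformly close to few geodesics, so it would have linear growth; an element
   of infinite order then generates a subgroup of finite index.  Branching gives
   a Poincare inequality on finitely supported functions, hence a contraction in
   l^2 for the lazy walk, and comparing with the central binomial term of the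
   lazy walk p^(n)(e,e) <= C lam^n with lam < 1.

   Ancona's inequality G(x,z) <= A G(x,p) G(p,z) for p near a geodesic from x to
   z.  A path from x to z avoiding a ball of radius t around a point near the
   geodesic has length exponential in t, so its contribution is doubly
   exponentially small; inserting balls of radius 2^k at distance 8.2^k from p,
   on both sides, costs only a convergent product of constants.

   Hoelder continuity.  Let u = G(.,x), v = G(.,y), with x and y in nearly the
   same direction.  On the sets {a : (a|x) < T} the walk started at a reaches a
   point w at distance about T from e before leaving a slightly larger such set,
   with probability comparable to G(a,w): leaving costs the tail of
   sum_b G(w,b) G(b,w), which converges thanks to the spectral gap.  Together
   with Ancona's inequality, this makes the oscillation of u/v contract by a
   fixed factor each time T decreases by a fixed amount.

   The word metric of S may differ from d, but geodesics of one are quasi-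
   geodesics of the other, so the Gromov products are comparable up to affine
   factors.  The estimate on the group passes to the boundary by continuity. *)
Require Import Defs.
From mathcomp Require Import all_boot all_order all_algebra.
From mathcomp Require Import all_classical all_reals all_analysis.
From mathcomp Require Import zify ring lra.

Import Order.TTheory GRing.Theory Num.Theory.
Import numFieldNormedType.Exports.

Local Open Scope classical_set_scope.
Local Open Scope ring_scope.

Set Implicit Arguments.
Unset Strict Implicit.
Unset Printing Implicit Defensive.

(** * Word metrics *)

(** The properties of a word length on which the geometric arguments rest: [geod_split] supplies
    geodesics and [geod_ball] finite balls. The length is kept abstract because two word metrics are
    compared later. *)
Record geodesic_length (Gamma : groupType) (len : Gamma -> nat) : Prop := {
  geod_len1 : len 1%g = 0%N;
  geod_eq0 : forall x, len x = 0%N -> x = 1%g;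
  geod_lenV : forall x, len (x^-1)%g = len x;
  geod_lenM : forall x y, (len (x * y)%g <= len x + len y)%N;
  geod_split : forall x k, (k <= len x)%N ->
    exists a b, [/\ x = (a * b)%g, len a = k & len b = (len x - k)%N];
  geod_ball : forall n, exists s : seq Gamma,
    uniq s /\ forall x, (x \in s) = (len x <= n)%N }.

Section WordLength.
Variables (Gamma : groupType) (S : set Gamma).
Hypothesis S_gen : symmetric_generating_set S.
Local Notation wl := (word_length S).

Lemma symmetric_generating_word g : exists n, is_word_of_length S g n.
Proof.
case: S_gen => _ SV Sg.
suff : [set: Gamma] `<=` [set g | exists n, is_word_of_length S g n] by exact.
rewrite -Sg; apply: smallest_sub; last first.
  move=> s Ss; exists 1%N, [:: s]; split=> //; last by rewrite big_seq1.
  by move=> t; rewrite inE => /eqP ->.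
split.
- by exists 0%N, [::]; split=> //; rewrite big_nil.
- move=> x y [n [u [su Su <-]]] [m [v [sv Sv <-]]].
  exists (n + m)%N, (u ++ v); split; first by rewrite size_cat su sv.
    by move=> s; rewrite mem_cat => /orP[/Su|/Sv].
  by rewrite big_cat.
- move=> x [n [u [su Su <-]]]; exists n, (rev [seq (s^-1)%g | s <- u]); split.
  + by rewrite size_rev size_map.
  + by move=> s; rewrite mem_rev => /mapP[t /Su St ->]; exact: SV.
  + by rewrite -map_rev big_map prodgV revK.
Qed.

Lemma word_lengthP g :
  is_word_of_length S g (wl g) /\
  forall m, is_word_of_length S g m -> (wl g <= m)%N.
Proof.
have [n0 w0] := symmetric_generating_word g.
have ex : exists n, `[< is_word_of_length S g n >] by exists n0; apply/asboolP.
apply: (@getPex _ [set n | is_word_of_length S g n /\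
  forall m, is_word_of_length S g m -> (n <= m)%N]).
case: (ex_minnP ex) => n /asboolP wn nmin; exists n; split=> // m wm.
by apply: nmin; apply/asboolP.
Qed.

Lemma word_length_le g n : is_word_of_length S g n -> (wl g <= n)%N.
Proof. by move=> w; have [_] := word_lengthP g; apply. Qed.

Lemma word_length1 : wl 1%g = 0%N.
Proof.
by apply/eqP; rewrite -leqn0; apply: word_length_le; exists [::]; rewrite big_nil.
Qed.

Lemma word_length_eq0 x : wl x = 0%N -> x = 1%g.
Proof.
move=> lx; have [[u [su _ <-]] _] := word_lengthP x.
by move: su; rewrite lx => /size0nil ->; rewrite big_nil.
Qed.

Lemma word_lengthM x y : (wl (x * y)%g <= wl x + wl y)%N.
Proof.
have [[u [su Su ux]] _] := word_lengthP x.
have [[v [sv Sv vy]] _] := word_lengthP y.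
apply: word_length_le; exists (u ++ v); split; first by rewrite size_cat su sv.
  by move=> s; rewrite mem_cat => /orP[/Su|/Sv].
by rewrite big_cat /= ux vy.
Qed.

Lemma word_lengthV x : wl (x^-1)%g = wl x.
Proof.
suff le y : (wl (y^-1)%g <= wl y)%N.
  by apply/eqP; rewrite eqn_leq le -{1}[x]invgK le.
have [[u [su Su uy]] _] := word_lengthP y; rewrite -su.
apply: word_length_le; exists (rev [seq (s^-1)%g | s <- u]); split.
+ by rewrite size_rev size_map.
+ move=> s; rewrite mem_rev => /mapP[t /Su St ->].
  by case: S_gen => _ SV _; exact: SV.
+ by rewrite -map_rev big_map prodgV revK uy.
Qed.

Lemma word_length_split x k : (k <= wl x)%N ->
  exists a b, [/\ x = (a * b)%g, wl a = k & wl b = (wl x - k)%N].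
Proof.
have [[u [su Su ux]] _] := word_lengthP x => kx.
pose a := (\prod_(s <- take k u) s)%g; pose b := (\prod_(s <- drop k u) s)%g.
have xab : x = (a * b)%g by rewrite /a /b -big_cat cat_take_drop.
have la : (wl a <= k)%N.
  apply: word_length_le; exists (take k u); split=> //.
    by rewrite size_takel // su.
  by move=> s /mem_take /Su.
have lb : (wl b <= wl x - k)%N.
  apply: word_length_le; exists (drop k u); split=> //.
    by rewrite size_drop su.
  by move=> s /mem_drop /Su.
exists a, b; have := word_lengthM a b; rewrite -xab.
by split=> //; lia.
Qed.

Lemma word_length_ball n : exists s : seq Gamma,
  uniq s /\ forall x, (x \in s) = (wl x <= n)%N.
Proof.
suff [s sP] : exists s : seq Gamma, forall x, (wl x <= n)%N -> x \in s.
  exists (undup [seq x <- s | (wl x <= n)%N]); split; first exact: undup_uniq.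
  move=> x; rewrite mem_undup mem_filter.
  by apply/andP/idP => [[]//|lx]; split=> //; exact: sP.
case: S_gen => /finite_seqP[L SL] _ _.
elim: n => [|n [s sP]].
  exists [:: 1%g] => x; rewrite leqn0 => /eqP lx.
  by rewrite (word_length_eq0 lx) inE.
exists (s ++ [seq (a * b)%g | a <- L, b <- s]) => x lx; rewrite mem_cat.
apply/orP; case: (leqP (wl x) n) => [/sP|nx]; first by left.
right; have [[[//|t u] [su Su ux]] _] := word_lengthP x.
  by rewrite -su in nx.
rewrite -ux big_cons; apply: allpairs_f.
  by have : S t := Su t (mem_head _ _); rewrite SL.
apply: sP; apply: (@leq_trans (size u)); last by move: su lx => /= <-.
apply: word_length_le; exists u; split=> // s' s'u.
by apply: Su; rewrite inE s'u orbT.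
Qed.

Lemma word_length_geodesic : geodesic_length wl.
Proof.
split; [exact: word_length1|exact: word_length_eq0|exact: word_lengthV|exact: word_lengthM|
  exact: word_length_split|exact: word_length_ball].
Qed.

End WordLength.

(** * Left-invariant distance, geodesics and the four-point condition *)

Section Distance.
Variables (Gamma : groupType) (len : Gamma -> nat).
Hypothesis geod : geodesic_length len.
Local Open Scope nat_scope.

Definition dist x y := len (x^-1 * y)%g.

Lemma dist1 x : dist 1%g x = len x.
Proof. by rewrite /dist invg1 mul1g. Qed.

Lemma distxx x : dist x x = 0.
Proof. by rewrite /dist mulVg geod_len1. Qed.

Lemma distC x y : dist x y = dist y x.
Proof. by rewrite /dist -(geod_lenV geod) invgM invgK. Qed.

Lemma dist_triangle z x y : dist x y <= dist x z + dist z y.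
Proof.
rewrite /dist (_ : x^-1 * y = (x^-1 * z) * (z^-1 * y))%g ?geod_lenM //.
by rewrite mulgA mulgK.
Qed.

Lemma distMl g x y : dist (g * x)%g (g * y)%g = dist x y.
Proof. by rewrite /dist invgM -mulgA mulKg. Qed.

Lemma dist_mulr x s : dist x (x * s)%g = len s.
Proof. by rewrite /dist mulKg. Qed.

Lemma geodesic_point x y k : k <= dist x y ->
  exists z, dist x z = k /\ dist z y = dist x y - k.
Proof.
move=> /(geod_split geod)[a [b [xy la lb]]].
exists (x * a)%g; rewrite dist_mulr; split=> //.
by rewrite -lb /dist invgM -mulgA xy mulKg.
Qed.

Definition lball n : seq Gamma := sval (cid (geod_ball geod n)).

Lemma lball_uniq n : uniq (lball n).
Proof. by rewrite /lball; case: cid => s /= []. Qed.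

Lemma mem_lball n x : (x \in lball n) = (len x <= n).
Proof. by rewrite /lball; case: cid => s /= []. Qed.

(* With doubled Gromov products this is
   [min (x|y) (y|z) - D / 2 <= (x|z)] based at [w]. *)
Definition four_point D := forall x y z w,
  dist x z + dist y w <= maxn (dist x y + dist z w) (dist x w + dist y z) + D.

End Distance.

(** Moving the base point to [w] by left translation and doubling the Gromov products turns
    hyperbolicity into an inequality between natural numbers; [D] is an integer above
    [2 * delta]. *)
Lemma word_length_four_point (R : realType) (Gamma : groupType)
    (S : set Gamma) : symmetric_generating_set S -> gromov_hyperbolic R S ->
  exists D, four_point (word_length S) D.
Proof.
move=> S_gen [delta delta_ge0 hyp].
have geod := word_length_geodesic S_gen.
pose D := (Num.truncn (2 * delta)%R).+1; exists D => x y z w.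
have dD : 2 * delta <= D%:R :> R.
  exact/ltW/truncnS_gt.
have tr u v : word_dist S (w^-1 * u)%g (w^-1 * v)%g = dist (word_length S) u v.
  by rewrite -(distMl _ w^-1%g).
have e u : word_length S (w^-1 * u)%g = dist (word_length S) w u by [].
have := hyp (w^-1 * x)%g (w^-1 * z)%g (w^-1 * y)%g.
rewrite /gromov_product !tr !e (distC geod w) (distC geod w z) (distC geod w y).
move: (dist _ x w) (dist _ y w) (dist _ z w) => xw yw zw.
move: (dist _ x y) (dist _ y z) (dist _ x z) => xy yz xz.
rewrite lerBlDr ge_min => H.
rewrite addn_maxl leq_max -!(ler_nat R) !natrD; apply/orP.
by case/orP: H => H; [left|right]; lra.
Qed.

(** * Branching of nonelementary hyperbolic groups *)

Section Subgroups.
Variable Gamma : groupType.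

Lemma subgroup_smallest (X : set Gamma) : subgroup (smallest (@subgroup Gamma) X).
Proof.
split.
- by move=> H [[]].
- by move=> x y Hx Hy H HH; case: (HH) => -[_ HM _] _; apply: HM; [exact: Hx|exact: Hy].
- by move=> x Hx H HH; case: (HH) => -[_ _ HV] _; apply: HV; exact: Hx.
Qed.

Lemma mem_cyclic_subgroup (g : Gamma) n : cyclic_subgroup g (g ^+ n)%g.
Proof.
have [H1 HM _] := subgroup_smallest [set g].
elim: n => [|n IHn]; first by rewrite expg0.
by rewrite expgS; apply: HM => //; move=> H [_]; apply.
Qed.

Lemma subgroup_coset_eq (H : set Gamma) x y : subgroup H -> H (y^-1 * x)%g ->
  [set (x * h)%g | h in H] = [set (y * h)%g | h in H].
Proof.
move=> [_ HM HV] Hyx; apply/seteqP; split=> _ [h Hh <-].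
  by exists (y^-1 * x * h)%g; [exact: HM|rewrite -mulgA mulVKg].
exists ((y^-1 * x)^-1 * h)%g; first by apply: HM => //; exact: HV.
by rewrite invgM invgK -!mulgA mulVKg.
Qed.

End Subgroups.

Lemma leq_size_fibers (T K : eqType) (U : seq T) (keys : seq K)
    (r : T -> K -> bool) W :
  (forall u, u \in U -> has (r u) keys) ->
  (forall k, k \in keys -> (count (r^~ k) U <= W)%N) ->
  (size U <= size keys * W)%N.
Proof.
move=> Uk kW; apply: (@leq_trans (\sum_(u <- U) count (r u) keys)).
  by rewrite -sum1_size big_seq [leqRHS]big_seq leq_sum// => u /Uk; rewrite has_count.
under eq_bigr do rewrite -sum1_count big_mkcond.
rewrite exchange_big /=; apply: (@leq_trans (\sum_(k <- keys) W)); last first.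
  by rewrite big_const_seq count_predT iter_addn_0 mulnC.
rewrite big_seq [leqRHS]big_seq; apply: leq_sum => k /kW.
by rewrite -sum1_count big_mkcond.
Qed.

Section NonelementaryHyperbolic.
Variables (Gamma : groupType) (len : Gamma -> nat) (D : nat).
Hypothesis geod : geodesic_length len.
Hypothesis hyp : four_point len D.
Local Notation d := (dist len).
Local Notation ball := (lball geod).
Local Open Scope nat_scope.

Lemma dist1' x : d x 1%g = len x.
Proof. by rewrite (distC geod) dist1. Qed.

Lemma four_pointP x y z w :
  d x z + d y w <= d x y + d z w + D \/ d x z + d y w <= d x w + d y z + D.
Proof. by have := hyp x y z w; rewrite addn_maxl leq_max => /orP. Qed.

Lemma size_ball_le m n : m <= n -> size (ball m) <= size (ball n).
Proof.
move=> mn; apply: uniq_leq_size; first exact: lball_uniq.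
by move=> x; rewrite !mem_lball => /leq_trans; apply.
Qed.

Lemma size_le_ball (F : seq Gamma) (f : Gamma -> Gamma) n :
  uniq F -> injective f -> (forall x : Gamma, x \in F -> len (f x) <= n) ->
  size F <= size (ball n).
Proof.
move=> Funiq f_inj Ff; rewrite -(size_map f); apply: uniq_leq_size.
  by rewrite (map_inj_uniq f_inj).
by move=> _ /mapP[x xF ->]; rewrite mem_lball; exact: Ff.
Qed.

(** The four-point condition for [1], [g], [g ^+ 2], [g ^+ n.+3] leaves two cases: the induction
    hypothesis excludes the first, and the second is the next strict increase. *)
Lemma strict_powers g : len g + D < len (g ^+ 2)%g ->
  forall n, len (g ^+ n)%g < len (g ^+ n.+1)%g.
Proof.
move=> lg; have gpos : 0 < len g.
  by have := geod_lenM geod g g; rewrite -expg2; lia.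
elim=> [|[|n] IHn]; first by rewrite expg0 (geod_len1 geod).
  by rewrite expg1; lia.
have e m : d g (g ^+ m.+1)%g = len (g ^+ m)%g by rewrite expgS dist_mulr.
have := four_pointP 1%g g (g ^+ 2)%g (g ^+ n.+3)%g.
have -> : d (g ^+ 2)%g (g ^+ n.+3)%g = len (g ^+ n.+1)%g.
  by rewrite (expgnDr g 2 n.+1) dist_mulr.
by rewrite !e !dist1 expg1; lia.
Qed.

(** If the index were infinite, more than [A * len g] cosets would have representatives of length at
    most some [C]. Their products with [N] powers of [g] are distinct and of length at most
    [C + N * len g], too many for linear growth when [N] is large. *)
Lemma cyclic_finite_index_linear_growth (A : nat) g :
  (forall n, size (ball n) <= A * n.+1) ->
  (forall n, len (g ^+ n)%g < len (g ^+ n.+1)%g) ->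
  finite_index (cyclic_subgroup g).
Proof.
move=> linear incr; apply: contrapT => infin.
pose coset x := [set (x * h)%g | h in cyclic_subgroup g].
have [B [Buniq Bsub Bsize]] : exists B : seq (set Gamma),
    [/\ uniq B, forall c, c \in B -> exists x, coset x = c & A * len g < size B].
  have [B Bsub Bsize] := infinite_set_fset (A * len g).+1 infin.
  exists (finmap.enum_fset B); split=> //; first exact: finmap.fset_uniq.
  by move=> c /Bsub[x _ <-]; exists x.
have repP (c : set Gamma) : exists x, c \in B -> c = coset x.
  have [cB|] := boolP (c \in B); last by exists 1%g.
  by have [x <-] := Bsub c cB; exists x.
pose rep c := sval (cid (repP c)).
have repE c : c \in B -> coset (rep c) = c.
  by move=> cB; rewrite [RHS](svalP (cid (repP c)) cB).
pose C := \max_(c <- B) len (rep c).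
(* Large enough for [(A * len g + 1) * N] to exceed [A * (C + N * len g + 1)]. *)
pose N := (A * C.+1).+1.
have len_pow n : len (g ^+ n)%g <= n * len g.
  elim: n => [|n IHn]; first by rewrite expg0 (geod_len1 geod).
  by rewrite expgS mulSn; apply: leq_trans (geod_lenM geod _ _) _; rewrite leq_add2l.
have pow_inj : injective (fun n => g ^+ n)%g.
  have mono m n : m < n -> len (g ^+ m)%g < len (g ^+ n)%g.
    by move=> mn; exact: (homo_ltn ltn_trans incr).
  move=> m n mn; case: (ltngtP m n) => // /mono; by rewrite /= mn ltnn.
pose L := [seq (rep c * g ^+ m)%g | c <- B, m <- iota 0 N].
have Luniq : uniq L.
  apply: allpairs_uniq; [exact: Buniq|exact: iota_uniq|].
  move=> [a b] [a' b'] /allpairsPdep[a1 [b1 [aB _ [ea _]]]].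
  move=> /allpairsPdep[a2 [b2 [a'B _ [ea' _]]]] /= E.
  rewrite -{}ea in aB; rewrite -{}ea' in a'B.
  have aa' : a = a'.
    rewrite -(repE a) // -(repE a') //; apply: subgroup_coset_eq.
      exact: subgroup_smallest.
    have [_ HM HV] := subgroup_smallest [set g].
    have -> : ((rep a')^-1 * rep a = g ^+ b' * (g ^+ b)^-1)%g.
      by rewrite -[rep a](mulgK (g ^+ b)%g) E -!mulgA mulKg.
    by apply: HM; [|apply: HV]; exact: mem_cyclic_subgroup.
  by move: E; rewrite aa' => /mulgI /pow_inj ->.
have Lsize : size L = size B * N by rewrite size_allpairs size_iota.
have Lball : {subset L <= ball (C + N * len g)}.
  move=> x /allpairsPdep[c [m [cB]]]; rewrite mem_iota => /andP[_ mN] ->.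
  rewrite mem_lball; apply: leq_trans (geod_lenM geod _ _) _.
  apply: leq_add; last by apply: leq_trans (len_pow _) _; rewrite leq_mul2r; lia.
  exact: leq_bigmax_seq.
have := uniq_leq_size Luniq Lball; rewrite Lsize.
move/leq_trans/(_ (linear _)) => H.
have : (A * len g).+1 * N <= A * (C + N * len g).+1.
  by apply: leq_trans H; rewrite leq_mul2r Bsize orbT.
rewrite {1}/N; nia.
Qed.

Hypothesis nonel : nonelementary Gamma.

(** In a finite group the trivial subgroup has finite index; hence there are arbitrarily long
    elements, and their prefixes have all smaller lengths. *)
Lemma nonelementary_sphere n : exists g, len g = n.
Proof.
apply: contrapT => none; apply: nonel; exists 1%g.
have small g : len g < n.
  rewrite ltnNge; apply/negP => /(geod_split geod)[a [b [_ la _]]].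
  by apply: none; exists a.
apply: finite_image; apply/finite_seqP; exists (ball n).
by apply/seteqP; split=> // x _ /=; rewrite mem_lball ltnW.
Qed.

(** Place the midpoint of a geodesic of length [R + R] at [g]: by the four-point condition one of
    its two ends moves away from [y], up to [D]. *)
Lemma geodesic_extension y g R : exists p, d g p = R /\ d y g + R <= d y p + D.
Proof.
have [h lh] := nonelementary_sphere (R + R).
have [|a [b [hab la lb]]] := geod_split geod (x := h) (k := R); first by lia.
have lb' : len b = R by lia.
have da : d g (g * a^-1)%g = R by rewrite dist_mulr (geod_lenV geod).
have db : d g (g * b)%g = R by rewrite dist_mulr.
have dab : d (g * a^-1)%g (g * b)%g = R + R.
  by rewrite distMl /dist invgK -hab.
have := four_pointP y (g * a^-1)%g g (g * b)%g; rewrite (distC geod (g * a^-1)%g g) da db dab.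
case: (leqP (d y (g * a^-1)%g) (d y (g * b)%g)) => le H.
  by exists (g * b)%g; split=> //; lia.
by exists (g * a^-1)%g; split=> //; lia.
Qed.

(** Take [a] and [b] of equal length in opposite directions. If neither satisfies the criterion of
    [strict_powers], each points in nearly the same direction as its inverse. Then [a * b] starts
    along [a], its inverse starts along the inverse of [b], hence along [b], and the square of
    [a * b] has little cancellation. *)
Lemma exists_strict_powers : exists g, forall n, len (g ^+ n)%g < len (g ^+ n.+1)%g.
Proof.
suff [g gP] : exists g, len g + D < len (g ^+ 2)%g.
  by exists g; exact: strict_powers.
pose R := (6 * D).+1.
have [h lh] := nonelementary_sphere (R + R).
have [|a' [b [hab la' lb']]] := geod_split geod (x := h) (k := R); first by lia.
have lb : len b = R by lia.
have [a [la dab]] : exists a, len a = R /\ d a b = R + R.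
  by exists (a'^-1)%g; rewrite geod_lenV // /dist invgK -hab.
case: (ltnP (len a + D) (len (a ^+ 2)%g)) => [|ga]; first by exists a.
case: (ltnP (len b + D) (len (b ^+ 2)%g)) => [|gb]; first by exists b.
exists (a * b)%g; pose g := (a * b)%g.
have sq x : d x (x^-1)%g = len (x ^+ 2)%g.
  by rewrite /dist -invgM (geod_lenV geod) expg2.
have lg : len g = d (a^-1)%g b by rewrite /dist invgK.
have daa : d a (a^-1)%g <= R + D by rewrite sq -la.
have dbb : d b (b^-1)%g <= R + D by rewrite sq -lb.
have dgg : d g (g^-1)%g = len (g ^+ 2)%g by exact: sq.
have dga : d g a = R by rewrite (distC geod) dist_mulr.
have dgb : d (g^-1)%g (b^-1)%g = R.
  by rewrite /g invgM (distC geod) dist_mulr (geod_lenV geod).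
have lV x : len (x^-1)%g = len x by exact: geod_lenV.
rewrite -/g in dgg *; rewrite -dgg.
have lg2 := geod_lenM geod a b; rewrite -/g in lg2.
have := four_pointP a 1%g b (a^-1)%g.
rewrite !dist1 !dist1' ?lV (distC geod b (a^-1)%g) -lg => H1.
have := four_pointP g a 1%g b; rewrite !dist1 !dist1' => H2.
have := four_pointP b 1%g g (b^-1)%g.
rewrite !dist1 !dist1' ?lV (distC geod g (b^-1)%g) (distC geod b g) => H3.
have := four_pointP (b^-1)%g 1%g g (g^-1)%g.
rewrite !dist1 !dist1' !lV (distC geod (b^-1)%g (g^-1)%g) => H4.
clearbody g; rewrite /R in la lb daa dbb dab dga dgb.
by lia.
Qed.

Definition outward (L : nat) (g z : Gamma) := (len z == L) && (len g + L <= len (g * z)%g + 5 * D).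

(** The points [q * z^-1] are at distance [L] from [q] and nearly on geodesics from [1] to [q], so
    they are within [6 * D] of each other. *)
Lemma outward_multiplicity (L : nat) (q : Gamma) :
  count (fun z => outward L (q * z^-1)%g z) (ball L) <= size (ball (6 * D)).
Proof.
rewrite -size_filter; set F := (X in size X <= _).
have FP (z : Gamma) : z \in F -> len z = L /\ len (q * z^-1)%g + L <= len q + 5 * D.
  by rewrite mem_filter /outward mulgVK => /andP[/andP[/eqP]] //.
case E : F => [//|z0 s]; rewrite -E.
have [lz0 oz0] : len z0 = L /\ len (q * z0^-1)%g + L <= len q + 5 * D.
  by apply: FP; rewrite E mem_head.
apply: (size_le_ball (f := fun z : Gamma => z0 * z^-1)%g).
- by rewrite filter_uniq ?lball_uniq.
- by move=> x y /mulgI /invg_inj.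
move=> z /FP[lz oz].
have := four_pointP 1%g (q * z0^-1)%g q (q * z^-1)%g; rewrite !dist1.
have -> : d (q * z0^-1)%g (q * z^-1)%g = len (z0 * z^-1)%g.
  by rewrite distMl /dist invgK.
have dq y : d q (q * y^-1)%g = len y by rewrite dist_mulr geod_lenV.
by rewrite (distC geod _ q) !dq; lia.
Qed.

(** Seen from [y = g^-1], the outward [z] are the points of the sphere of radius [L] lying away from
    [y]. A ball of radius [n] is placed in that region. Each point [p] of it is close to a geodesic
    from [1] to some outward [z], so the pair of [z] and [len p] determines [p] up to [3 * D]. *)
Lemma outward_few_linear n L g : L = 4 * n -> 5 * D < n ->
  count (outward L g) (ball L) <= size (ball (6 * D)) ->
  size (ball n) <= size (ball (6 * D)) * (3 * n).+1 * size (ball (3 * D)).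
Proof.
move=> LE nD few; pose y := (g^-1)%g.
have outE z : outward L g z = (len z == L) && (len y + L <= d y z + 5 * D).
  by rewrite /outward /y geod_lenV // /dist invgK.
have [z0 [lz0 oz0]] := geodesic_extension y 1%g L.
rewrite dist1 dist1' in lz0 oz0.
(* Half-way to [z0], the ball of radius [n] around [x] keeps away from [1] and from the direction of
   [y], and stays inside the sphere of radius [L = 4 * n]. *)
have [|x [lx xz0]] := geodesic_point geod (x := 1%g) (y := z0) (k := 2 * n).
  by rewrite dist1; lia.
rewrite !dist1 lz0 in lx xz0.
pose keys := [seq (z, j) | z <- [seq z <- ball L | outward L g z], j <- iota 0 (3 * n).+1].
pose r q (k : Gamma * nat) :=
  (len (x * q)%g == k.2) && (len (x * q)%g + d (x * q)%g k.1 <= L + 2 * D).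
have fiber (k : Gamma * nat) : k \in keys -> count (r^~ k) (ball n) <= size (ball (3 * D)).
  case: k => z j /allpairsPdep[z' [j' [+ _ [ez _]]]]; rewrite -{}ez.
  rewrite mem_filter outE => /andP[/andP[/eqP lz _] _] {z' j'}.
  rewrite -size_filter; set F := (X in size X <= _).
  have FP (q : Gamma) : q \in F -> len (x * q)%g = j /\ j + d (x * q)%g z <= L + 2 * D.
    by rewrite mem_filter /r /= => /andP[/andP[/eqP -> ]].
  case E : F => [//|q0 s]; rewrite -E.
  have [lq0 oq0] := FP q0 ltac:(by rewrite E mem_head).
  apply: (size_le_ball (f := fun q : Gamma => q0^-1 * q)%g).
  - by rewrite filter_uniq ?lball_uniq.
  - by move=> ? ? /mulgI.
  move=> q /FP[lq oq].
  have := four_pointP 1%g (x * q0)%g z (x * q)%g; rewrite !dist1 distMl.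
  rewrite (distC geod z) lq lq0 -/(dist len q0 q); lia.
have cover q : q \in ball n -> has (r q) keys.
  rewrite mem_lball => lq; pose p := (x * q)%g.
  have dxp : d x p = len q by rewrite dist_mulr.
  have tri := dist_triangle geod.
  have := tri x 1%g p; have := tri p 1%g x; rewrite !dist1 (distC geod p x) dxp => T1 T2.
  have := tri x y z0; rewrite xz0 => T3.
  have H2 : len y + len p <= d y p + 2 * D.
    by have := four_pointP 1%g y p x; rewrite !dist1 (distC geod p x) dxp; lia.
  (* The point [e] lies beyond [p] and outside the sphere of radius [L]. A geodesic from [1] to [e]
     passes within [2 * D] of [p], at [q'], and then meets the sphere at the outward point [z]. *)
  have [e [pe le]] := geodesic_extension 1%g p (L + D).
  rewrite !dist1 in le.
  have [|q' [lq' q'e]] := geodesic_point geod (x := 1%g) (y := e) (k := len p).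
    by rewrite dist1; lia.
  rewrite !dist1 in lq' q'e.
  have := four_pointP 1%g p e q'; rewrite !dist1 pe (distC geod e q') => H3.
  have dpq' : d p q' <= 2 * D by lia.
  have [|z [q'z ze]] := geodesic_point geod (x := q') (y := e) (k := L - len p).
    by lia.
  have lz : len z = L.
    have := tri q' 1%g z; have := tri z 1%g e; rewrite !dist1.
    by lia.
  have := four_pointP 1%g q' z y; rewrite !dist1 (distC geod z y) => H4.
  have := tri q' y p; rewrite (distC geod q' p) (distC geod y q') => T5.
  have yz : len y + L <= d y z + 5 * D by lia.
  apply/hasP; exists (z, len p).
    apply: allpairs_f; last by rewrite mem_iota; lia.
    by rewrite mem_filter outE lz eqxx yz mem_lball lz /=.
  rewrite /r /= eqxx /=; have := tri q' p z; rewrite -/p; lia.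
apply: leq_trans (leq_size_fibers cover fiber) _.
by rewrite leq_mul2r size_allpairs size_iota size_filter leq_mul2r few !orbT.
Qed.

(** If branching failed for every [L], [outward_few_linear] would give linear growth, and an element
    with strictly increasing powers would generate a subgroup of finite index. *)
Lemma nonelementary_branching : exists L, forall g,
  size (ball (6 * D)) < count (outward L g) (ball L).
Proof.
apply: contrapT => none.
have few L : exists g, count (outward L g) (ball L) <= size (ball (6 * D)).
  apply: contrapT => many; apply: none; exists L => g.
  by rewrite ltnNge; apply/negP => le; apply: many; exists g.
have [g incr] := exists_strict_powers; apply: nonel; exists g.
pose V := size (ball (6 * D)); pose W := size (ball (3 * D)).
apply: (@cyclic_finite_index_linear_growth (V * W * (15 * D + 7))) => // n.
have [h hfew] := few (4 * (n + 5 * D).+1).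
have := outward_few_linear (erefl _) _ hfew; rewrite -/V -/W => le.
apply: leq_trans (size_ball_le (n := (n + 5 * D).+1) _) _; first by lia.
apply: leq_trans (le _) _; first by lia.
by rewrite mulnAC -[leqRHS]mulnA leq_mul2l; apply/orP; right; nia.
Qed.

End NonelementaryHyperbolic.

(** * Spectral gap *)

Section FiniteSupport.
Variables (R : realType) (Gamma : groupType).
Implicit Types (f h : Gamma -> R) (A : seq Gamma).

Definition fin_supp f := exists A, forall x, x \notin A -> f x = 0.

(** By convention a sum with infinite support is [0], whence the [fin_supp] hypotheses in the rules
    below. *)
Definition gsum f : R := \sum_(x \in [set: Gamma]) f x.

Lemma gsumE A f : uniq A -> (forall x, x \notin A -> f x = 0) ->
  gsum f = \sum_(x <- A) f x.
Proof.
move=> Auniq fA; rewrite /gsum (fsbigE A) //; last by move=> x _ /fA.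
by apply: eq_bigl => x; rewrite mem_set.
Qed.

Lemma fin_supp_add f h : fin_supp f -> fin_supp h -> fin_supp (fun x => f x + h x).
Proof.
move=> [A fA] [B hB]; exists (A ++ B) => x.
by rewrite mem_cat negb_or => /andP[/fA -> /hB ->]; rewrite addr0.
Qed.

Lemma fin_supp_mull f h : fin_supp h -> fin_supp (fun x => f x * h x).
Proof. by move=> [B hB]; exists B => x /hB ->; rewrite mulr0. Qed.

Lemma fin_supp_mulr f h : fin_supp f -> fin_supp (fun x => f x * h x).
Proof. by move=> [B hB]; exists B => x /hB ->; rewrite mul0r. Qed.

Lemma fin_supp_sqr f : fin_supp f -> fin_supp (fun x => f x ^+ 2).
Proof. by move=> [B hB]; exists B => x /hB ->; rewrite expr0n. Qed.

Lemma fin_supp_shift f s : fin_supp f -> fin_supp (fun x => f (x * s)%g).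
Proof.
move=> [A fA]; exists [seq (a * s^-1)%g | a <- A] => x xA.
by apply: fA; apply: contra xA => /(map_f (fun a => a * s^-1)%g); rewrite mulgK.
Qed.

Lemma fin_supp_sum (I : Type) (r : seq I) (F : I -> Gamma -> R) :
  (forall i, fin_supp (F i)) -> fin_supp (fun x => \sum_(i <- r) F i x).
Proof.
move=> FA; elim: r => [|i r [A rA]]; first by exists [::] => x _; rewrite big_nil.
have [B iB] := FA i; exists (A ++ B) => x.
by rewrite mem_cat negb_or big_cons => /andP[/rA -> /iB ->]; rewrite addr0.
Qed.

Lemma gsumD f h : fin_supp f -> fin_supp h ->
  gsum (fun x => f x + h x) = gsum f + gsum h.
Proof.
move=> [A fA] [B hB]; have u := undup_uniq (A ++ B).
have fAB x : x \notin undup (A ++ B) -> f x = 0.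
  by rewrite mem_undup mem_cat negb_or => /andP[/fA].
have hAB x : x \notin undup (A ++ B) -> h x = 0.
  by rewrite mem_undup mem_cat negb_or => /andP[_ /hB].
rewrite (gsumE u fAB) (gsumE u hAB) -big_split /=; apply: gsumE => // x xAB.
by rewrite fAB // hAB // addr0.
Qed.

Lemma gsumZ c f : fin_supp f -> gsum (fun x => c * f x) = c * gsum f.
Proof.
move=> [A fA]; have fA' x : x \notin undup A -> f x = 0 by rewrite mem_undup => /fA.
rewrite (gsumE (undup_uniq _) fA') mulr_sumr; apply: gsumE => [|x /fA' ->].
  exact: undup_uniq.
by rewrite mulr0.
Qed.

Lemma gsum_sum (I : Type) (r : seq I) (F : I -> Gamma -> R) :
  (forall i, fin_supp (F i)) ->
  gsum (fun x => \sum_(i <- r) F i x) = \sum_(i <- r) gsum (F i).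
Proof.
move=> FA; elim: r => [|i r IHr].
  by rewrite big_nil (gsumE (A := [::])) ?big_nil // => x _; rewrite big_nil.
rewrite big_cons -IHr -gsumD //; last exact: fin_supp_sum.
by congr gsum; apply/funext => x; rewrite big_cons.
Qed.

Lemma le_gsum f h : fin_supp f -> fin_supp h -> (forall x, f x <= h x) ->
  gsum f <= gsum h.
Proof.
move=> [A fA] [B hB] fh; have u := undup_uniq (A ++ B).
rewrite (gsumE u) ?(gsumE (f := h) u); first exact: ler_sum.
  by move=> x; rewrite mem_undup mem_cat negb_or => /andP[_ /hB].
by move=> x; rewrite mem_undup mem_cat negb_or => /andP[/fA].
Qed.

Lemma gsum_ge0 f : (forall x, 0 <= f x) -> 0 <= gsum f.
Proof. by move=> f0; apply: fsumr_ge0 => x _. Qed.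

Lemma gsum_shift f s : gsum (fun x => f (x * s)%g) = gsum f.
Proof.
rewrite [RHS](reindex_fsbigT (fun x : Gamma => x * s)%g) //.
by exists (fun x => x * s^-1)%g => x; rewrite ?mulgK ?mulgVK.
Qed.

Lemma le_gsum_point f x0 : fin_supp f -> (forall x, 0 <= f x) -> f x0 <= gsum f.
Proof.
move=> [A fA] f0; have u := undup_uniq (x0 :: A).
rewrite (gsumE u); last first.
  by move=> x; rewrite mem_undup inE negb_or => /andP[_ /fA].
rewrite (bigD1_seq x0 _ u); last by rewrite mem_undup mem_head.
by rewrite lerDl sumr_ge0.
Qed.

End FiniteSupport.

Lemma sqr_mean_le (R : realType) (I : eqType) (r : seq I) (w a : I -> R) :
  (forall i, 0 <= w i) -> \sum_(i <- r) w i = 1 ->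
  (\sum_(i <- r) w i * a i) ^+ 2 <= \sum_(i <- r) w i * a i ^+ 2.
Proof.
move=> w0 w1; set m := \sum_(i <- r) w i * a i.
have : 0 <= \sum_(i <- r) w i * (a i - m) ^+ 2.
  by apply: sumr_ge0 => i _; rewrite mulr_ge0 // sqr_ge0.
have e i : w i * (a i - m) ^+ 2 = w i * a i ^+ 2 + ((- 2 * m) * (w i * a i) + m ^+ 2 * w i).
  by ring.
under eq_bigr do rewrite e.
rewrite !big_split /= -!mulr_sumr w1 -/m; nra.
Qed.

Record finite_walk (R : realType) (Gamma : groupType) (mu : Gamma -> R)
    (ms : seq Gamma) : Prop := {
  walk_uniq : uniq ms;
  walk_ge0 : forall s, 0 <= mu s;
  walk_out : forall s, s \notin ms -> mu s = 0;
  walk_sum : \sum_(s <- ms) mu s = 1 }.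

Section Walk.
Variables (R : realType) (Gamma : groupType) (mu : Gamma -> R) (ms : seq Gamma).
Hypothesis walk : finite_walk mu ms.
Implicit Types (f xi : Gamma -> R) (x y z s : Gamma).
Local Notation p := (nstep mu).
Let mu_ge0 := walk_ge0 walk.

Definition markov_op f x : R := \sum_(s <- ms) mu s * f (x * s)%g.

Lemma nstepS n x y : p n.+1 x y = markov_op (p n ^~ y) x.
Proof.
rewrite /= /transition (reindex_fsbigT (fun s => x * s)%g); last first.
  by exists (fun s => x^-1 * s)%g => s; rewrite ?mulKg ?mulVKg.
rewrite -/(gsum _) (gsumE (walk_uniq walk)) => [|s sms]; last first.
  by rewrite mulKg (walk_out walk) // mul0r.
by apply: eq_bigr => s _; rewrite mulKg.
Qed.

Lemma markov_opD f h x :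
  markov_op (fun y => f y + h y) x = markov_op f x + markov_op h x.
Proof. by rewrite /markov_op -big_split; apply: eq_bigr => s _; rewrite mulrDr. Qed.

Lemma markov_opZ c f x : markov_op (fun y => c * f y) x = c * markov_op f x.
Proof. by rewrite /markov_op mulr_sumr; apply: eq_bigr => s _; rewrite mulrCA. Qed.

Lemma markov_op_sum (I : Type) (r : seq I) (F : I -> Gamma -> R) x :
  markov_op (fun y => \sum_(i <- r) F i y) x = \sum_(i <- r) markov_op (F i) x.
Proof. by rewrite exchange_big; apply: eq_bigr => s _; rewrite mulr_sumr. Qed.

Lemma le_markov_op f h x : (forall s, s \in ms -> f (x * s)%g <= h (x * s)%g) ->
  markov_op f x <= markov_op h x.
Proof.
move=> fh; rewrite /markov_op big_seq [leRHS]big_seq.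
by apply: ler_sum => s /fh; exact: ler_wpM2l.
Qed.

Lemma markov_op_ge0 f x : (forall y, 0 <= f y) -> 0 <= markov_op f x.
Proof. by move=> f0; apply: sumr_ge0 => s _; rewrite mulr_ge0. Qed.

Lemma nstep_ge0 n x y : 0 <= p n x y.
Proof.
elim: n x => [|n IHn] x; first by rewrite /= ler0n.
by rewrite nstepS; apply: markov_op_ge0.
Qed.

Lemma nstepMl n g x y : p n (g * x)%g (g * y)%g = p n x y.
Proof.
elim: n x => [|n IHn] x; first by rewrite /= (inj_eq (mulgI g)).
by rewrite !nstepS; apply: eq_bigr => s _; rewrite -mulgA IHn.
Qed.

Lemma nstepSr n x y :
  p n.+1 x y = \sum_(s <- ms) mu s * p n x (y * s^-1)%g.
Proof.
elim: n x => [|n IHn] x.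
  rewrite nstepS; apply: eq_bigr => s _ /=.
  by rewrite -(inj_eq (mulIg s^-1%g)) mulgK.
rewrite nstepS /markov_op; under eq_bigr do rewrite IHn mulr_sumr.
rewrite exchange_big; apply: eq_bigr => t _; rewrite nstepS mulr_sumr.
by apply: eq_bigr => s _; rewrite mulrCA.
Qed.

(** Chapman-Kolmogorov, only an inequality because [B] may miss intermediate points. *)
Lemma nstep_conv_le n m (B : seq Gamma) x y : uniq B ->
  \sum_(b <- B) p n x b * p m b y <= p (n + m)%N x y.
Proof.
move=> Buniq; elim: n x => [|n IHn] x.
  rewrite /= add0n; have [xB|xB] := boolP (x \in B).
    rewrite (bigD1_seq x) //= eqxx mul1r big1 ?addr0 // => b.
    by rewrite eq_sym => /negPf ->; rewrite mul0r.
  rewrite big_seq big1 ?nstep_ge0 // => b bB.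
  by rewrite (_ : x == b = false) ?mul0r //; apply: contraNF xB => /eqP ->.
rewrite addSn nstepS; under eq_bigr do rewrite nstepS mulr_suml.
rewrite exchange_big; apply: ler_sum => s _ /=.
apply: le_trans (ler_wpM2l (mu_ge0 s) (IHn _)).
by rewrite mulr_sumr; apply: ler_sum => b _; rewrite mulrA.
Qed.

Lemma nstep_comp_le n m x y z : p n x y * p m y z <= p (n + m)%N x z.
Proof. by have := @nstep_conv_le n m [:: y] x z isT; rewrite big_seq1. Qed.

Lemma nstep_diag n x : p n x x = p n 1%g 1%g.
Proof. by rewrite -(nstepMl n x 1%g 1%g) !mulg1. Qed.

Hypothesis nondeg : nondegenerate_walk mu.

Lemma nstep_reach g : exists n, 0 < p n 1%g g.
Proof.
suff : [set: Gamma] `<=` [set g | exists n, 0 < p n 1%g g] by exact.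
rewrite -nondeg; apply: smallest_sub.
  move=> x y [n xn] [m ym]; exists (n + m)%N.
  apply: lt_le_trans (nstep_comp_le n m _ x _).
  by rewrite mulr_gt0 //; rewrite -(nstepMl m x) mulg1 in ym.
move=> s /= mus; exists 1%N; rewrite nstepS /markov_op.
have sms : s \in ms by apply/negPn/negP => /(walk_out walk) /eqP; rewrite (negPf mus).
rewrite (bigD1_seq s) //=; last exact: walk_uniq walk.
rewrite mul1g eqxx mulr1 ltr_pwDl ?lt0r ?mus ?mu_ge0 //.
by apply: sumr_ge0 => t _; rewrite mulr_ge0.
Qed.

Definition dirichlet s xi := gsum (fun x => (xi (x * s)%g - xi x) ^+ 2).

Definition energy xi := \sum_(s <- ms) mu s * dirichlet s xi.

Lemma dirichlet_ge0 s xi : 0 <= dirichlet s xi.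
Proof. by apply: gsum_ge0 => x; exact: sqr_ge0. Qed.

Lemma energy_ge0 xi : 0 <= energy xi.
Proof. by apply: sumr_ge0 => s _; rewrite mulr_ge0 // dirichlet_ge0. Qed.

Lemma fin_supp_diff xi s : fin_supp xi -> fin_supp (fun x => xi (x * s)%g - xi x).
Proof.
move=> fxi; apply: fin_supp_add; first exact: fin_supp_shift.
by under eq_fun do rewrite -mulN1r; exact: fin_supp_mull.
Qed.

(** The elements admitting such a [C] form a semigroup, since the increment along [x * y] splits in
    two and [(u + v)^2 <= 2 u^2 + 2 v^2]. It contains the support, with [C = (mu s)^-1]. *)
Lemma dirichlet_le_energy g : exists2 C, 0 <= C &
  forall xi, fin_supp xi -> dirichlet g xi <= C * energy xi.
Proof.
suff : [set: Gamma] `<=` [set g | exists2 C, 0 <= C &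
  forall xi, fin_supp xi -> dirichlet g xi <= C * energy xi] by exact.
rewrite -nondeg; apply: smallest_sub => /=; last first.
  move=> s mus; exists (mu s)^-1; first by rewrite invr_ge0.
  move=> xi fxi; have mus0 : 0 < mu s by rewrite lt0r mus mu_ge0.
  have sms : s \in ms by apply/negPn/negP => /(walk_out walk) /eqP; rewrite (negPf mus).
  rewrite ler_pdivlMl // /energy (bigD1_seq s) //=; last exact: walk_uniq walk.
  by rewrite lerDl; apply: sumr_ge0 => t _; rewrite mulr_ge0 // dirichlet_ge0.
move=> x y /= [C C0 Cx] [C' C'0 C'y]; exists (2 * C + 2 * C') => [|xi fxi].
  by rewrite addr_ge0 // mulr_ge0.
have -> : (2 * C + 2 * C') * energy xi = 2 * (C * energy xi) + 2 * (C' * energy xi).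
  by ring.
have := Cx xi fxi; have := C'y xi fxi; rewrite /dirichlet.
rewrite -(gsum_shift (fun z => (xi (z * y)%g - xi z) ^+ 2) x) => Hy Hx.
suff : gsum (fun z => (xi (z * (x * y))%g - xi z) ^+ 2) <=
  2 * gsum (fun z => (xi (z * x)%g - xi z) ^+ 2) +
  2 * gsum (fun z => (xi (z * x * y)%g - xi (z * x)%g) ^+ 2) by lra.
have f1 : fin_supp (fun z => (xi (z * x)%g - xi z) ^+ 2).
  by apply: fin_supp_sqr; exact: fin_supp_diff.
have f2 : fin_supp (fun z => (xi (z * x * y)%g - xi (z * x)%g) ^+ 2).
  apply: fin_supp_sqr.
  exact: (@fin_supp_shift _ _ (fun z => xi (z * y)%g - xi z) x (fin_supp_diff _ _)).
rewrite -!gsumZ // -gsumD; [|exact: fin_supp_mull|exact: fin_supp_mull].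
apply: le_gsum => [||z].
- by apply: fin_supp_sqr; exact: fin_supp_diff.
- by apply: fin_supp_add; exact: fin_supp_mull.
rewrite mulgA; set a := xi (z * x * y)%g; set b := xi (z * x)%g.
by have := sqr_ge0 ((b - xi z) - (a - b)); lra.
Qed.

(* The branching makes a finitely supported function count itself [V + 1] times
   along outward pairs, while each of its values is counted only [V] times from
   the other end. *)
Lemma poincare (o : Gamma -> Gamma -> bool) (Z : seq Gamma) (V : nat) :
  (forall g, (V < count (o g) Z)%N) ->
  (forall q, (count (fun z => o (q * z^-1)%g z) Z <= V)%N) ->
  exists2 C, 0 <= C &
    forall xi, fin_supp xi -> gsum (fun x => xi x ^+ 2) <= C * energy xi.
Proof.
move=> branching multiplicity.
pose Cz z := s2val (cid2 (dirichlet_le_energy z)).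
have Cz0 z : 0 <= Cz z by rewrite /Cz; case: cid2.
have CzP z xi : fin_supp xi -> dirichlet z xi <= Cz z * energy xi.
  by rewrite /Cz; case: cid2 => /= C _; apply.
pose M := \sum_(z <- Z) Cz z.
have M0 : 0 <= M by apply: sumr_ge0.
exists (2 * (2 * V%:R + 2) * M) => [|xi fxi].
  by rewrite !mulr_ge0 // addr_ge0 // mulr_ge0.
set N := gsum _; have N0 : 0 <= N by apply: gsum_ge0 => x; exact: sqr_ge0.
have fxi2 := fin_supp_sqr fxi.
have count_sum a : \sum_(z <- Z) (a z : bool)%:R = (count a Z)%:R :> R.
  by rewrite -natr_sum -sum1_count [in RHS]big_mkcond; congr (_%:R).
have lower : (V%:R + 1) * N <= \sum_(z <- Z) gsum (fun g => (o g z)%:R * xi g ^+ 2).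
  rewrite -gsum_sum; last by move=> z; exact: fin_supp_mull.
  rewrite -gsumZ //; apply: le_gsum; first exact: fin_supp_mull.
    by apply: fin_supp_sum => z; exact: fin_supp_mull.
  move=> g; rewrite -mulr_suml count_sum ler_wpM2r ?sqr_ge0 //.
  by rewrite natr1 ler_nat branching.
have upper : \sum_(z <- Z) gsum (fun g => (o g z)%:R * xi (g * z)%g ^+ 2) <= V%:R * N.
  under eq_bigr => z _.
    rewrite -[gsum _](gsum_shift _ z^-1%g).
    under eq_fun do rewrite mulgVK.
    over.
  rewrite -gsum_sum; last by move=> z; exact: fin_supp_mull.
  rewrite -gsumZ //; apply: le_gsum; last 1 first.
  - move=> g; rewrite -mulr_suml (count_sum (fun z => o (g * z^-1)%g z)).
    by rewrite ler_wpM2r ?sqr_ge0 // ler_nat multiplicity.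
  - by apply: fin_supp_sum => z; exact: fin_supp_mull.
  - exact: fin_supp_mull.
(* With this weight [(1 + t) * V <= V + 1 / 2], which leaves half of [N] to be bounded by the
   energy, and [1 + t^-1 = 2 * V + 2]. *)
pose t : R := (2 * V%:R + 1)^-1.
have V0 : 0 <= V%:R :> R by [].
have t0 : 0 < t by rewrite invr_gt0; lra.
have tV : (2 * V%:R + 1) * t = 1 by rewrite mulfV //; lra.
have mid z : gsum (fun g => (o g z)%:R * xi g ^+ 2) <=
    (1 + t) * gsum (fun g => (o g z)%:R * xi (g * z)%g ^+ 2) +
    (2 * V%:R + 2) * dirichlet z xi.
  have f1 : fin_supp (fun g => (o g z)%:R * xi (g * z)%g ^+ 2).
    apply: fin_supp_mull; apply: fin_supp_sqr; exact: fin_supp_shift.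
  have f2 : fin_supp (fun g => (xi (g * z)%g - xi g) ^+ 2).
    by apply: fin_supp_sqr; exact: fin_supp_diff.
  rewrite -!gsumZ // -gsumD; [|exact: fin_supp_mull|exact: fin_supp_mull].
  apply: le_gsum => [||g].
  - exact: fin_supp_mull.
  - by apply: fin_supp_add; exact: fin_supp_mull.
  move: (xi _) (xi g) => b a.
  have -> : 2 * V%:R + 2 = 1 + t^-1 by rewrite invrK; lra.
  have key : a ^+ 2 <= (1 + t) * b ^+ 2 + (1 + t^-1) * (b - a) ^+ 2.
    have -> : (1 + t) * b ^+ 2 + (1 + t^-1) * (b - a) ^+ 2 =
      a ^+ 2 + t^-1 * ((1 + t) * b - a) ^+ 2 by field; rewrite gt_eqF.
    by rewrite lerDl mulr_ge0 ?sqr_ge0 // invr_ge0 ltW.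
  case: (o g z); rewrite ?mul1r // !mul0r mulr0 add0r.
  by rewrite mulr_ge0 ?sqr_ge0 // addr_ge0 // invr_ge0 ltW.
have sumD : \sum_(z <- Z) dirichlet z xi <= M * energy xi.
  by rewrite mulr_suml; apply: ler_sum => z _; exact: CzP.
have : (V%:R + 1) * N <= (1 + t) * (V%:R * N) + (2 * V%:R + 2) * (M * energy xi).
  apply: le_trans lower _; apply: le_trans (ler_sum _ (fun z _ => mid z)) _.
  rewrite big_split /= -!mulr_sumr lerD // ler_wpM2l //; lra.
have e0 : 0 <= M * energy xi by rewrite mulr_ge0 // energy_ge0.
have -> : 2 * (2 * V%:R + 2) * M * energy xi = 2 * ((2 * V%:R + 2) * (M * energy xi)).
  by ring.
have tN : (1 + t) * (V%:R * N) <= V%:R * N + N / 2.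
  have -> : (1 + t) * (V%:R * N) = V%:R * N + (V%:R * t) * N by ring.
  rewrite lerD2l [leRHS]mulrC ler_wpM2r //; nra.
set X := _ * (M * _); lra.
Qed.

Definition lazy_op f x : R := (f x + markov_op f x) / 2.

Lemma fin_supp_markov f : fin_supp f -> fin_supp (markov_op f).
Proof.
by move=> ff; apply: fin_supp_sum => s; apply: fin_supp_mull; exact: fin_supp_shift.
Qed.

Lemma fin_supp_lazy f : fin_supp f -> fin_supp (lazy_op f).
Proof.
by move=> ff; apply: fin_supp_mulr; apply: fin_supp_add => //; exact: fin_supp_markov.
Qed.

(** The identity [((a + b) / 2)^2 = a^2 / 2 + b^2 / 2 - (a - b)^2 / 4] is averaged over the steps by
    Jensen's inequality; after summation over the group, shift invariance merges the first two
    terms. *)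
Lemma lazy_contraction xi : fin_supp xi ->
  gsum (fun x => lazy_op xi x ^+ 2) <= gsum (fun x => xi x ^+ 2) - energy xi / 4.
Proof.
move=> fxi; have f0 := fin_supp_sqr fxi.
have f1 s : fin_supp (fun x => xi (x * s)%g ^+ 2).
  by apply: fin_supp_sqr; exact: fin_supp_shift.
have f2 s : fin_supp (fun x => (xi (x * s)%g - xi x) ^+ 2).
  by apply: fin_supp_sqr; exact: fin_supp_diff.
pose F s x := mu s * (2^-1 * xi x ^+ 2 + (2^-1 * xi (x * s)%g ^+ 2 +
                      (- 4^-1) * (xi (x * s)%g - xi x) ^+ 2)).
have fF s : fin_supp (F s).
  apply: fin_supp_mull; apply: fin_supp_add; first exact: fin_supp_mull.
  by apply: fin_supp_add; exact: fin_supp_mull.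
apply: (@le_trans _ _ (gsum (fun x => \sum_(s <- ms) F s x))).
  apply: le_gsum => [||x].
  - by apply: fin_supp_sqr; exact: fin_supp_lazy.
  - exact: fin_supp_sum.
  have -> : lazy_op xi x = \sum_(s <- ms) mu s * ((xi x + xi (x * s)%g) / 2).
    have e : xi x = \sum_(s <- ms) mu s * xi x.
      by rewrite -mulr_suml (walk_sum walk) mul1r.
    rewrite /lazy_op [in LHS]e -big_split mulr_suml.
    by apply: eq_bigr => s _; rewrite mulrA mulrDr.
  apply: le_trans (sqr_mean_le _ (walk_ge0 walk) (walk_sum walk)) _.
  by apply: ler_sum => s _; rewrite /F ler_wpM2l //; lra.
rewrite gsum_sum //.
have -> : gsum (fun x => xi x ^+ 2) - energy xi / 4 =
   \sum_(s <- ms) mu s * (gsum (fun x => xi x ^+ 2) - dirichlet s xi / 4).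
  under eq_bigr do rewrite mulrBr.
  rewrite sumrB -mulr_suml (walk_sum walk) mul1r; congr (_ - _).
  by rewrite mulr_suml; apply: eq_bigr => s _; rewrite mulrA.
apply: ler_sum => s _; rewrite /F gsumZ; last first.
  apply: fin_supp_add; first exact: fin_supp_mull.
  by apply: fin_supp_add; exact: fin_supp_mull.
rewrite ler_wpM2l //.
rewrite !gsumD ?gsumZ //; try exact: fin_supp_mull; last first.
  by apply: fin_supp_add; exact: fin_supp_mull.
rewrite (gsum_shift (fun x => xi x ^+ 2)) /dirichlet; lra.
Qed.

Definition lazy_walk n : Gamma -> R := iter n lazy_op (fun x => (x == 1%g)%:R).

(** [lazy_walk N] is the [N]-th power of [(I + P) / 2] applied to the point mass at [1]; one term of
    its binomial expansion is kept. *)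
Lemma nstep_le_lazy N k x :
  'C(N, k)%:R / 2 ^+ N * p k x 1%g <= lazy_walk N x.
Proof.
have lazy0 n y : 0 <= lazy_walk n y.
  elim: n y => [|n IHn] y; first by rewrite /= ler0n.
  by rewrite /= /lazy_op divr_ge0 // addr_ge0 //; exact: markov_op_ge0.
elim: N k x => [|N IHN] k x.
  case: k => [|k]; first by rewrite bin0 expr0 divr1 mul1r.
  by rewrite bin0n mul0r mul0r.
rewrite /= -/(lazy_walk N) /lazy_op exprS.
have two0 : 0 <= 2 ^+ N :> R by rewrite exprn_ge0.
case: k => [|k].
  rewrite bin0; have := IHN 0%N x; rewrite bin0.
  have := @markov_op_ge0 (lazy_walk N) x (lazy0 N).
  by rewrite invfM; set c := (2 ^+ N)^-1; lra.
have step : 'C(N, k)%:R / 2 ^+ N * p k.+1 x 1%g <= markov_op (lazy_walk N) x.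
  by rewrite nstepS -markov_opZ; apply: le_markov_op => s _; exact: IHN.
have := IHN k.+1 x; rewrite binS natrD invfM.
move: step; set c := (2 ^+ N)^-1; lra.
Qed.

End Walk.

(** The induction rests on [(n + 1) C(2n + 2, n + 1) = 2 (2n + 1) C(2n, n)]. *)
Lemma central_binomial_ge n : (4 ^ n <= (2 * n).+1 * 'C(2 * n, n))%N.
Proof.
elim: n => [//|n IHn].
have e : (n.+1 * 'C(2 * n.+1, n.+1) = 2 * (2 * n).+1 * 'C(2 * n, n))%N.
  rewrite (_ : 2 * n.+1 = (2 * n).+2)%N; last by lia.
  have e1 := mul_bin_diag (2 * n).+2 n; have e2 := mul_bin_down (2 * n).+1 n.
  rewrite /= (_ : (2 * n).+1 - n = n.+1)%N in e1 e2; last by lia.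
  by apply/eqP; rewrite -(eqn_pmul2l (ltn0Sn n)) -e1; apply/eqP; nia.
have : (n.+1 * 4 ^ n.+1 <= n.+1 * ((2 * n.+1).+1 * 'C(2 * n.+1, n.+1)))%N.
  rewrite expnS; nia.
by rewrite leq_pmul2l.
Qed.

(** * Green function *)

Lemma cvg_sum_seq (R : realType) (I : Type) (r : seq I) (F : I -> nat -> R)
    (l : I -> R) : (forall i, F i n @[n --> \oo] --> l i) ->
  \sum_(i <- r) F i n @[n --> \oo] --> \sum_(i <- r) l i.
Proof.
move=> Fl; elim: r => [|i r IHr].
  by rewrite big_nil; under eq_fun do rewrite big_nil; exact: cvg_cst.
by rewrite big_cons; under eq_fun do rewrite big_cons; exact: cvgD.
Qed.

(** * Exponential decay of the return probabilities *)

Section SpectralGap.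
Variables (R : realType) (Gamma : groupType) (mu : Gamma -> R) (ms : seq Gamma).
Hypothesis walk : finite_walk mu ms.

Lemma bernoulli_le (t : R) n : 0 <= t -> 1 + n%:R * t <= (1 + t) ^+ n.
Proof.
move=> t0; elim: n => [|n IHn]; first by rewrite mul0r addr0.
rewrite exprS -natr1; apply: le_trans (ler_wpM2l _ IHn); last by rewrite addr_ge0.
have : 0 <= n%:R * t ^+ 2 by rewrite mulr_ge0 // sqr_ge0.
by lra.
Qed.

(** The Poincare inequality turns the energy loss of [lazy_contraction] into a factor [1 - t] on the
    squared norm. At lazy time [2 * n] the central binomial weight is at least [1 / (2 * n + 1)],
    which transfers the decay to [nstep] at time [n]. *)
Lemma nstep_decay (K : R) : 0 <= K ->
  (forall xi, fin_supp xi -> gsum (fun x => xi x ^+ 2) <= K * energy mu ms xi) ->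
  exists C lam : R, [/\ 0 < C, 0 < lam < 1 &
    forall n, nstep mu n 1%g 1%g <= C * lam ^+ n].
Proof.
move=> K0 KP; pose t := (4 * (K + 1))^-1.
have t0 : 0 < t by rewrite invr_gt0; lra.
have t14 : t <= 4^-1 by rewrite lef_pV2 ?posrE; lra.
have contr xi : fin_supp xi -> gsum (fun x => lazy_op mu ms xi x ^+ 2) <=
    (1 - t) * gsum (fun x => xi x ^+ 2).
  move=> fxi; apply: le_trans (lazy_contraction walk fxi) _.
  have e0 := energy_ge0 walk xi.
  have : gsum (fun x => xi x ^+ 2) <= (K + 1) * energy mu ms xi.
    by apply: le_trans (KP _ fxi) _; rewrite ler_wpM2r //; lra.
  have eK : (K + 1) * t = 4^-1.
    by rewrite /t invfM mulrCA mulfV ?mulr1 // gt_eqF //; lra.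
  move/(ler_wpM2r (ltW t0)); rewrite mulrAC eK; lra.
have fin n : fin_supp (lazy_walk mu ms n).
  elim: n => [|n IHn]; last exact: fin_supp_lazy.
  by exists [:: 1%g] => x; rewrite inE /= => /negPf ->.
have decay n : gsum (fun x => lazy_walk mu ms n x ^+ 2) <= (1 - t) ^+ n.
  elim: n => [|n IHn]; last first.
    apply: le_trans (contr _ (fin n)) _; rewrite exprS ler_wpM2l //; lra.
  rewrite expr0 (gsumE (A := [:: 1%g])) //; last first.
    by move=> x; rewrite inE /= => /negPf ->; rewrite expr0n.
  by rewrite big_seq1 /= eqxx expr1n.
(* Bernoulli's inequality absorbs the factor [2 * n + 1] into [2 / t * (1 + t) ^+ n]; the resulting
   rate is [1 - t ^+ 2]. *)
exists (2 / t), ((1 + t) * (1 - t)); split.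
- by rewrite divr_gt0.
- by apply/andP; split; nra.
move=> n; have t1n : 0 <= (1 - t) ^+ n by rewrite exprn_ge0 //; lra.
have lz : lazy_walk mu ms (2 * n) 1%g <= (1 - t) ^+ n.
  have := decay (2 * n)%N; rewrite mulnC exprM => h.
  have : lazy_walk mu ms (n * 2) 1%g ^+ 2 <= ((1 - t) ^+ n) ^+ 2.
    apply: le_trans h; apply: (le_gsum_point (f := fun x => lazy_walk mu ms (n * 2) x ^+ 2)).
      exact: fin_supp_sqr.
    by move=> x; exact: sqr_ge0.
  move=> h2; apply: le_trans (ler_norm _) _.
  by rewrite -(ger0_norm t1n) -[leLHS]sqrtr_sqr -[leRHS]sqrtr_sqr ler_wsqrtr.
have pn0 := nstep_ge0 walk n 1%g 1%g.
have := nstep_le_lazy walk (2 * n) n 1%g.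
have -> : 2 ^+ (2 * n) = (4 ^ n)%:R :> R by rewrite exprM natrX -natrX.
move=> h.
have bin : (4 ^ n)%:R <= (2 * n).+1%:R * 'C(2 * n, n)%:R :> R.
  by rewrite -natrM ler_nat central_binomial_ge.
have p4 : 0 < (4 ^ n)%:R :> R by rewrite ltr0n expn_gt0.
have pl : nstep mu n 1%g 1%g <= (2 * n).+1%:R * (1 - t) ^+ n.
  have h2 := le_trans h lz.
  have : nstep mu n 1%g 1%g <= (2 * n).+1%:R * ('C(2 * n, n)%:R / (4 ^ n)%:R * nstep mu n 1%g 1%g).
    rewrite !mulrA ler_peMl // ler_pdivlMr // mul1r; exact: bin.
  by move/le_trans; apply; exact: ler_wpM2l.
apply: le_trans pl _; rewrite exprMn mulrA ler_wpM2r //.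
have := bernoulli_le n (ltW t0).
have -> : (2 * n).+1%:R = 2 * n%:R + 1 :> R by rewrite -natr1 natrM.
move=> b; have : 2 / t * (1 + n%:R * t) <= 2 / t * (1 + t) ^+ n.
  by rewrite ler_wpM2l // divr_ge0 // ltW.
apply: le_trans.
have -> : 2 / t * (1 + n%:R * t) = 2 * n%:R + 2 / t by field; rewrite gt_eqF.
rewrite lerD2l ler_pdivlMr //; lra.
Qed.

End SpectralGap.

(** * Transience and basic estimates of the Green function *)

Record transient_walk (R : realType) (Gamma : groupType) (len : Gamma -> nat)
    (mu : Gamma -> R) (ms : seq Gamma) (C lam : R) : Prop := {
  tw_walk : finite_walk mu ms;
  tw_nondeg : nondegenerate_walk mu;
  tw_C : 0 < C;
  tw_lam : 0 < lam < 1;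
  tw_decay : forall n, nstep mu n 1%g 1%g <= C * lam ^+ n }.

Definition greenr (R : realType) (Gamma : groupType) (mu : Gamma -> R) x y :=
  fine (green mu x y).

Section Green.
Variables (R : realType) (Gamma : groupType) (len : Gamma -> nat).
Variables (mu : Gamma -> R) (ms : seq Gamma) (C lam : R).
Hypothesis geod : geodesic_length len.
Hypothesis tw : transient_walk len mu ms C lam.
Implicit Types (x y z : Gamma).
Local Notation d := (dist len).
Local Notation p := (nstep mu).
Local Notation G := (greenr mu).
Local Notation P := (markov_op mu ms).
Let walk := tw_walk tw.
Let p_ge0 := nstep_ge0 walk.
Let C0 := tw_C tw.
Let lam0 : 0 < lam. Proof. by case/andP: (tw_lam tw). Qed.
Let lam1 : lam < 1. Proof. by case/andP: (tw_lam tw). Qed.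

(** Balls of radius 1 are finite, so one [e] serves all unit steps; these are then chained along a
    geodesic. The number [n] of steps is not controlled. *)
Lemma nstep_harnack : exists2 e : R, 0 < e <= 1 &
  forall x y, exists n, e ^+ d x y <= p n x y.
Proof.
have [e e01 eP] : exists2 e : R, 0 < e <= 1 &
    forall s, len s = 1%N -> exists n, e <= p n 1%g s.
  suff [e e01 eP] : exists2 e : R, 0 < e <= 1 &
      forall s, s \in lball geod 1 -> exists n, e <= p n 1%g s.
    by exists e => // s ls; apply: eP; rewrite mem_lball ls.
  elim: (lball geod 1) => [|s l [e /andP[e0 e1] IH]]; first by exists 1; rewrite ?ltr01 /=.
  have [n pn] := nstep_reach walk (tw_nondeg tw) s.
  exists (Num.min e (p n 1%g s)); first by rewrite lt_min e0 pn ge_min e1.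
  move=> t; rewrite inE => /predU1P[->|/IH[m em]].
    by exists n; rewrite ge_min lexx orbT.
  by exists m; rewrite ge_min em.
exists e => // x y; have [k kd] : exists k, d x y = k by exists (d x y).
have e0 : 0 < e by case/andP: e01.
elim: k x y kd => [|k IHk] x y kd; rewrite kd.
  exists 0%N; rewrite expr0 /= (_ : x == y) //.
  by rewrite -eqg_inv -mulg_eq1; apply/eqP/(geod_eq0 geod).
have [|z [xz zy]] := geodesic_point geod (x := x) (y := y) (k := 1%N); first by rewrite kd.
have [n en] := eP (x^-1 * z)%g xz.
rewrite kd subn1 /= in zy; have [m em] := IHk _ _ zy; rewrite zy in em.
exists (n + m)%N; apply: le_trans (nstep_comp_le walk n m x z y).
rewrite -(mulVg x) (nstepMl walk) in en.
by rewrite exprS ler_pM // ?exprn_ge0 // ltW.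
Qed.

(** Closing the path by a return from [y] to [x] reduces the bound to return probabilities. *)
Lemma nstep_le_decay (e : R) n x y : 0 < e ->
  (exists m, e ^+ d y x <= p m y x) -> p n x y <= C / e ^+ d x y * lam ^+ n.
Proof.
move=> e0 [m em]; have ed : 0 < e ^+ d x y by exact: exprn_gt0.
rewrite mulrAC ler_pdivlMr // (distC geod).
apply: le_trans (ler_wpM2l (p_ge0 _ _ _) em) _.
apply: le_trans (nstep_comp_le walk n m x y x) _.
rewrite (nstep_diag walk); apply: le_trans (tw_decay tw _) _.
rewrite ler_wpM2l ?(ltW C0) // exprD ler_piMr ?exprn_ge0 ?(ltW lam0) //.
by rewrite exprn_ile1 ?ltW.
Qed.

Lemma geometric_sum_le n N : \sum_(N <= k < n) lam ^+ k <= lam ^+ N / (1 - lam).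
Proof.
have l1 : 0 < 1 - lam by rewrite subr_gt0.
rewrite ler_pdivlMr //; case: (leqP N n) => [Nn|/ltnW nN]; last first.
  by rewrite big_geq // mul0r exprn_ge0 // ltW.
have -> : (\sum_(N <= k < n) lam ^+ k) * (1 - lam) = lam ^+ N - lam ^+ n.
  elim: n Nn => [|n IHn].
    by rewrite leqn0 => /eqP ->; rewrite big_geq // mul0r subrr.
  rewrite leq_eqVlt => /predU1P[->|]; first by rewrite big_geq // mul0r subrr.
  rewrite ltnS => Nn; rewrite big_nat_recr //= mulrDl IHn // exprS; ring.
by rewrite gerBl exprn_ge0 // ltW.
Qed.

Definition green_sum n x y : R := \sum_(0 <= k < n) p k x y.

Lemma green_sumS n x y :
  green_sum n.+1 x y = (x == y)%:R + P (green_sum n ^~ y) x.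
Proof.
rewrite /green_sum big_nat_recl // markov_op_sum; congr (_ + _).
by apply: eq_bigr => k _; rewrite (nstepS walk).
Qed.

Lemma green_sum_ge0 n x y : 0 <= green_sum n x y.
Proof. by apply: sumr_ge0. Qed.

Lemma green_sum_homo m n x y : (m <= n)%N -> green_sum m x y <= green_sum n x y.
Proof.
by move=> mn; rewrite /green_sum [leRHS](big_cat_nat (n := m)) //= lerDl sumr_ge0.
Qed.

(** The geometric bound makes the extended-real series [green] finite, so that [fine] does not
    return its default value. *)
Lemma cvg_green_sum x y : green_sum n x y @[n --> \oo] --> G x y.
Proof.
have [e /andP[e0 e1] eP] := nstep_harnack.
have cv : cvgn (fun n => green_sum n x y).
  apply: nondecreasing_is_cvgn; first by move=> m n; exact: green_sum_homo.
  exists (C / e ^+ d x y * (lam ^+ 0 / (1 - lam))) => _ [n _ <-].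
  apply: (@le_trans _ _ (\sum_(0 <= k < n) C / e ^+ d x y * lam ^+ k)).
    by apply: ler_sum => k _; exact: nstep_le_decay.
  rewrite -mulr_sumr ler_wpM2l ?geometric_sum_le //.
  by rewrite divr_ge0 ?exprn_ge0 ?ltW.
suff -> : G x y = limn (fun n => green_sum n x y) by [].
rewrite /greenr /green; under [X in limn X]eq_fun do rewrite sumEFin.
by rewrite (EFin_lim cv).
Qed.

Lemma green_sum_le n x y : green_sum n x y <= G x y.
Proof.
rewrite -(cvg_lim _ (@cvg_green_sum x y)) //; apply: nondecreasing_cvgn_le.
  by move=> m k; exact: green_sum_homo.
by apply/cvg_ex; eexists; exact: cvg_green_sum.
Qed.

Lemma green_le c x y : (forall n, green_sum n x y <= c) -> G x y <= c.
Proof.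
move=> le; rewrite -(cvg_lim _ (@cvg_green_sum x y)) //; apply: limr_le.
  by apply/cvg_ex; eexists; exact: cvg_green_sum.
by apply: nearW.
Qed.

Lemma green_ge0 x y : 0 <= G x y.
Proof. exact: le_trans (green_sum_ge0 0 x y) (green_sum_le 0 x y). Qed.

Lemma green_diag_ge1 x : 1 <= G x x.
Proof.
apply: le_trans (green_sum_le 1 x x).
by rewrite /green_sum big_nat1 /= eqxx.
Qed.

Lemma greenMl g x y : G (g * x)%g (g * y)%g = G x y.
Proof.
rewrite /greenr /green; congr (fine (limn _)); apply/funext => n.
by apply: eq_bigr => k _; rewrite (nstepMl walk).
Qed.

Lemma green_diag x : G x x = G 1%g 1%g.
Proof. by rewrite -(greenMl x 1%g 1%g) !mulg1. Qed.

Lemma green_harmonic x y : G x y = (x == y)%:R + P (G ^~ y) x.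
Proof.
have cv1 := @cvg_green_sum x y.
have cv2 : (green_sum n.+1 x y @[n --> \oo]) --> (x == y)%:R + P (G ^~ y) x.
  under eq_fun do rewrite green_sumS.
  apply: cvgD; first exact: cvg_cst.
  rewrite /markov_op; apply: cvg_sum_seq => s.
  by apply: cvgM; [exact: cvg_cst|exact: cvg_green_sum].
apply: (cvg_unique _ _ cv2) => //.
by move: cv1; rewrite -(cvg_shiftS (fun n => green_sum n x y)).
Qed.

Lemma green_superharmonic x y : P (G ^~ y) x <= G x y.
Proof. by rewrite [leRHS]green_harmonic lerDr. Qed.

Lemma nstep_green m x y z : p m x y * G y z <= G x z.
Proof.
elim: m x => [|m IHm] x.
  by rewrite /=; have [->|_] := eqVneq x y; rewrite ?mul1r // mul0r green_ge0.
rewrite (nstepS walk); apply: le_trans (green_superharmonic x z).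
rewrite mulr_suml; apply: ler_sum => s _.
by rewrite -mulrA ler_wpM2l ?(walk_ge0 walk).
Qed.

(** After expansion of both Green functions, terms with fewer than [k] steps from [w] to [b] vanish.
    The others, summed over [b], are at most return probabilities in [i + j] steps. *)
Lemma green_conv_tail w k (B : seq Gamma) : uniq B ->
  (forall b n, b \in B -> (n < k)%N -> p n w b = 0) ->
  \sum_(b <- B) G w b * G b w <= C / (1 - lam) ^+ 2 * lam ^+ k.
Proof.
move=> Buniq far; set c := _ * lam ^+ k.
have l1 : 0 < 1 - lam by rewrite subr_gt0.
suff key n : \sum_(b <- B) green_sum n w b * green_sum n b w <= c.
  have cv : (\sum_(b <- B) green_sum n w b * green_sum n b w @[n --> \oo]) -->
      \sum_(b <- B) G w b * G b w.
    by apply: cvg_sum_seq => b; apply: cvgM; exact: cvg_green_sum.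
  rewrite -(cvg_lim _ cv) //; apply: limr_le; last by apply: nearW.
  by apply/cvg_ex; eexists; exact: cv.
have -> : \sum_(b <- B) green_sum n w b * green_sum n b w =
    \sum_(0 <= i < n) \sum_(0 <= j < n) \sum_(b <- B) p i w b * p j b w.
  rewrite /green_sum; under eq_bigr do rewrite mulr_suml.
  rewrite exchange_big; apply: eq_bigr => i _; under eq_bigr do rewrite mulr_sumr.
  by rewrite exchange_big.
apply: (@le_trans _ _ (\sum_(0 <= i < n | true && (k <= i)%N) C / (1 - lam) * lam ^+ i)).
  rewrite [leRHS]big_mkcond; apply: ler_sum => i _ /=; case: leqP => ki; last first.
    rewrite big1 // => j _; rewrite big_seq big1 // => b bB.
    by rewrite far // mul0r.
  apply: (@le_trans _ _ (\sum_(0 <= j < n) C * lam ^+ i * lam ^+ j)).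
    apply: ler_sum => j _; apply: le_trans (nstep_conv_le walk i j w w Buniq) _.
    by rewrite (nstep_diag walk) -mulrA -exprD (tw_decay tw).
  rewrite -mulr_sumr [leRHS]mulrAC; apply: ler_wpM2l.
    by rewrite mulr_ge0 ?exprn_ge0 // ltW.
  by have := geometric_sum_le n 0; rewrite expr0 mul1r.
rewrite -(big_nat_widenl _ 0) // -mulr_sumr.
have -> : c = C / (1 - lam) * (lam ^+ k / (1 - lam)) by rewrite /c; field; rewrite gt_eqF.
by rewrite ler_wpM2l ?geometric_sum_le // divr_ge0 // ltW.
Qed.

End Green.

(** * The reversed walk *)

Section Reversed.
Variables (R : realType) (Gamma : groupType) (len : Gamma -> nat).
Variables (mu : Gamma -> R) (ms : seq Gamma) (C lam : R).
Hypothesis tw : transient_walk len mu ms C lam.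

(** Reversal exchanges the arguments of the Green function, so estimates in the first variable carry
    over to the second. *)
Definition reversed_walk (g : Gamma) : R := mu (g^-1)%g.

Local Notation rms := [seq (s^-1)%g | s <- ms].

Lemma reversed_finite_walk : finite_walk reversed_walk rms.
Proof.
have walk := tw_walk tw; split.
- by rewrite (map_inj_uniq invg_inj); exact: walk_uniq walk.
- by move=> s; exact: walk_ge0 walk _.
- move=> s; rewrite -{1}[s]invgK (mem_map invg_inj); exact: walk_out walk _.
- rewrite big_map -(walk_sum walk); apply: eq_bigr => s _.
  by rewrite /reversed_walk invgK.
Qed.

Lemma nstep_reversed n x y : nstep reversed_walk n x y = nstep mu n y x.
Proof.
elim: n x => [|n IHn] x; first by rewrite /= eq_sym.
rewrite (nstepS reversed_finite_walk) (nstepSr (tw_walk tw)) /markov_op big_map.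
by apply: eq_bigr => s _; rewrite IHn /reversed_walk invgK.
Qed.

Lemma green_reversed x y : greenr reversed_walk x y = greenr mu y x.
Proof.
rewrite /greenr /green; congr (fine (limn _)); apply/funext => n.
by apply: eq_bigr => k _; rewrite nstep_reversed.
Qed.

Lemma transient_reversed : transient_walk len reversed_walk rms C lam.
Proof.
split; [exact: reversed_finite_walk| |exact: tw_C tw|exact: tw_lam tw|]; last first.
  by move=> n; rewrite nstep_reversed; exact: tw_decay tw n.
apply/seteqP; split=> // g _; rewrite -[g]invgK; move: (g^-1)%g => {}g.
suff : [set: Gamma] `<=`
  [set g | smallest (@subsemigroup Gamma) (walk_support reversed_walk) (g^-1)%g].
  by apply.
rewrite -(tw_nondeg tw); apply: smallest_sub => [x y /= sx sy|s /= mus]; last first.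
  by move=> A [_]; apply; rewrite /walk_support /reversed_walk /= invgK.
rewrite invgM => A AP; case: (AP) => HA _.
by apply: HA; [exact: sy|exact: sx].
Qed.

End Reversed.

(** * Paths avoiding a ball *)

Section Paths.
Variables (Gamma : groupType) (len : Gamma -> nat) (r D : nat).
Hypothesis geod : geodesic_length len.
Hypothesis hyp : four_point len D.
Local Notation d := (dist len).

(** Bisection: one half of the path has ends whose doubled Gromov product at [q] is larger by at
    most [D], and [j] halvings leave at most one step. Hence a path keeping away from [q] is
    exponentially long. *)
Lemma path_near_product (v : nat -> Gamma) q j i k : (k <= 2 ^ j)%N ->
  (forall l, (i <= l < i + k)%N -> (d (v l) (v l.+1) <= r)%N) ->
  exists2 l, (i <= l <= i + k)%N &
    (2 * d (v l) q + d (v i) (v (i + k)%N) <=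
     d (v i) q + d (v (i + k)%N) q + j * D + 2 * r)%N.
Proof.
elim: j i k => [|j IHj] i k kj step.
  exists i; first by lia.
  have [k0|k1] : k = 0%N \/ k = 1%N by move: kj; rewrite expn0; lia.
    by rewrite k0 addn0 distxx //; lia.
  have := step i; rewrite k1 addn1 leqnn ltnS leqnn => /(_ isT).
  by have := dist_triangle geod (v i.+1) (v i) q; lia.
pose k1 := minn k (2 ^ j); pose k2 := (k - k1)%N.
have k12 : k = (k1 + k2)%N by rewrite /k2 /k1; lia.
have [||l1 il1 H1] := IHj i k1; [by rewrite /k1; lia|by move=> l il; apply: step; lia|].
have [||l2 il2 H2] := IHj (i + k1)%N k2.
- by move: kj; rewrite expnS /k2 /k1; lia.
- by move=> l il; apply: step; lia.
rewrite -addnA -k12 in H2 il2; rewrite mulSn.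
case: (four_pointP hyp (v i) (v (i + k1)%N) (v (i + k)%N) q) => H.
  by exists l1; lia.
by exists l2; lia.
Qed.

End Paths.

(** * Killed walks and domination by superharmonic functions *)

Section GreenPotential.
Variables (R : realType) (Gamma : groupType) (len : Gamma -> nat).
Variables (mu : Gamma -> R) (ms : seq Gamma) (C lam e : R) (r D : nat).
Hypothesis geod : geodesic_length len.
Hypothesis hyp : four_point len D.
Hypothesis tw : transient_walk len mu ms C lam.
Hypothesis e01 : 0 < e <= 1.
Hypothesis harnack : forall x y, exists n, e ^+ dist len x y <= nstep mu n x y.
Hypothesis range : forall s, s \in ms -> (len s <= r)%N.
Implicit Types (x y z w a b q : Gamma).
Local Notation d := (dist len).
Local Notation p := (nstep mu).
Local Notation G := (greenr mu).
Local Notation P := (markov_op mu ms).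
Let walk := tw_walk tw.
Let mu_ge0 := walk_ge0 walk.
Let C0 := tw_C tw.
Let lam0 : 0 < lam. Proof. by case/andP: (tw_lam tw). Qed.
Let lam1 : lam < 1. Proof. by case/andP: (tw_lam tw). Qed.
Let e0 : 0 < e. Proof. by case/andP: e01. Qed.
Let e1 : e <= 1. Proof. by case/andP: e01. Qed.

Lemma green_harnackl x y z : e ^+ d x y * G y z <= G x z.
Proof.
have [n en] := harnack x y; apply: le_trans (nstep_green geod tw n x y z).
by rewrite ler_wpM2r // (green_ge0 geod tw).
Qed.

Lemma green_lower x y : e ^+ d x y <= G x y.
Proof.
apply: le_trans (green_harnackl x y y); rewrite ler_peMr ?exprn_ge0 ?(ltW e0) //.
exact: green_diag_ge1 geod tw y.
Qed.

Lemma green_gt0 x y : 0 < G x y.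
Proof. exact: lt_le_trans (exprn_gt0 _ e0) (green_lower x y). Qed.

Lemma nstep_out n x y : (r * n < d x y)%N -> p n x y = 0.
Proof.
elim: n x => [|n IHn] x; rewrite ?muln0 => far.
  by rewrite /=; case: eqP => // xy; rewrite xy distxx // in far.
rewrite (nstepS walk) /markov_op big_seq big1 // => s sms.
rewrite IHn ?mulr0 //; have := range sms; have := dist_triangle geod (x * s)%g x y.
by rewrite dist_mulr; rewrite mulnS in far; lia.
Qed.

(* Expected number of visits to [w] before time [n], for the walk killed when it
   leaves [Om]. *)
Fixpoint killed (Om : Gamma -> bool) w n a : R :=
  if n is n'.+1 then
    if Om a then (a == w)%:R + P (killed Om w n') a else 0
  else 0.

Lemma killed_out (Om : Gamma -> bool) w n a : ~~ Om a -> killed Om w n a = 0.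
Proof. by case: n => [//|n] /= /negPf ->. Qed.

(** After leaving [Om] at [b], the mean number of visits to [w] is at most [G b w <= h b], and the
    mean of the superharmonic [h] at the exit is at most [h a]. Only exit points within reach of [n]
    steps matter, which later allows [h] to be a finite sum. *)
Lemma green_sum_le_killed (Om : Gamma -> bool) w (h : Gamma -> R) n a :
  (forall b, 0 <= h b) -> (forall b, P h b <= h b) ->
  (forall b, ~~ Om b -> (d a b <= r * n)%N -> G b w <= h b) ->
  green_sum mu n a w <= h a + killed Om w n a.
Proof.
move=> h0 Ph; elim: n a => [|n IHn] a dom.
  by rewrite /= addr0 /green_sum big_geq.
have [Oa|nOa] := boolP (Om a); last first.
  rewrite killed_out // addr0; apply: le_trans (green_sum_le geod tw _ _ _) _.
  by apply: dom => //; rewrite distxx.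
rewrite /= Oa (green_sumS tw) addrCA lerD2l.
apply: le_trans (lerD (Ph a) (lexx _)); rewrite -markov_opD.
apply: le_markov_op => // s /range ls; apply: IHn => b nOb db; apply: dom => //.
apply: leq_trans (dist_triangle geod (a * s)%g _ _) _.
by rewrite dist_mulr mulnS leq_add.
Qed.

(** Domination principle: the visits to [w] inside [Om] number at most [G w w] times the probability
    of reaching [w], while [f a] is at least that probability times [f w], as [f] is nonnegative up
    to the exit points. *)
Lemma killed_le_superharmonic (Om : Gamma -> bool) w (f : Gamma -> R) n a :
  (forall b s, Om b -> s \in ms -> 0 <= f (b * s)%g) ->
  (forall b, Om b -> P f b <= f b) -> 0 <= f a ->
  killed Om w n a * f w <= G w w * f a.
Proof.
move=> f0 Pf; have Gw := green_ge0 geod tw w w.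
elim: n a => [|n IHn] a fa /=; first by rewrite mul0r mulr_ge0.
have [Oa|_] := ifPn; last by rewrite mul0r mulr_ge0.
have [aw|_] := eqVneq a w.
  rewrite -aw in fa *; rewrite ler_wpM2r //.
  apply: le_trans (green_sum_le geod tw n.+1 a a).
  rewrite (green_sumS tw) eqxx lerD2l; apply: le_markov_op => // s _.
  elim: n (a * s)%g {IHn} => [|n IHn] b /=; first by rewrite /green_sum big_geq.
  rewrite (green_sumS tw); case: (Om b); last first.
    by rewrite addr_ge0 // ?ler0n // markov_op_ge0 // => c; exact: green_sum_ge0 tw _ _ _.
  by rewrite lerD2l; apply: le_markov_op.
rewrite add0r; apply: le_trans (ler_wpM2l Gw (Pf _ Oa)).
rewrite mulrC -!markov_opZ; apply: le_markov_op => // s sms.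
by rewrite mulrC; apply: IHn; exact: f0.
Qed.

Lemma green_mul_le a w z : G a w * G w z <= G w w * G a z.
Proof.
have Gwz : 0 < G w z by exact: green_gt0.
rewrite -ler_pdivlMr //; apply: (green_le geod tw) => n; rewrite ler_pdivlMr //.
apply: le_trans (killed_le_superharmonic (Om := xpredT) (f := G ^~ z) w n _ _ _).
- rewrite ler_wpM2r ?(ltW Gwz) //.
  elim: n a => [|n IHn] a /=; first by rewrite /green_sum big_geq.
  by rewrite (green_sumS tw) lerD2l; apply: le_markov_op.
- by move=> *; exact: ltW (green_gt0 _ _).
- by move=> b _; exact: (green_superharmonic geod tw).
- exact: ltW (green_gt0 _ _).
Qed.

(** The contribution of time [k] to [killed]: short times can then be excluded geometrically and
    long ones bounded by the decay. *)
Fixpoint killed_step (Om : Gamma -> bool) w k a : R :=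
  if Om a then
    if k is k'.+1 then P (killed_step Om w k') a else (a == w)%:R
  else 0.

Lemma killed_sum (Om : Gamma -> bool) w n a :
  killed Om w n a = \sum_(0 <= k < n) killed_step Om w k a.
Proof.
elim: n a => [|n IHn] a; first by rewrite big_geq.
rewrite big_nat_recl //=; case: (Om a); last by rewrite add0r big1.
by congr (_ + _); rewrite -markov_op_sum; congr (P _ a); apply/funext => b.
Qed.

Lemma killed_step_le (Om : Gamma -> bool) w k a : killed_step Om w k a <= p k a w.
Proof.
elim: k a => [|k IHk] a; first by rewrite /=; case: (Om a); rewrite ?ler0n.
rewrite (nstepS walk) /=; case: (Om a); last first.
  by apply: markov_op_ge0 => // b; exact: nstep_ge0 walk _ _ _.
by apply: le_markov_op.
Qed.

Lemma killed_step_path (Om : Gamma -> bool) w k a : killed_step Om w k a != 0 ->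
  exists v : nat -> Gamma, [/\ v 0%N = a, v k = w,
    forall l, (l < k)%N -> (d (v l) (v l.+1) <= r)%N &
    forall l, (l <= k)%N -> Om (v l)].
Proof.
elim: k a => [|k IHk] a /=; case: ifPn => [Oa|]; rewrite ?eqxx //.
  case: (eqVneq a w) => [<-|]; rewrite ?eqxx // => _.
  by exists (fun=> a); split.
move=> P0; have [s sms s0] : exists2 s, s \in ms & killed_step Om w k (a * s)%g != 0.
  apply: contrapT => none; move/eqP: P0; apply.
  rewrite /markov_op big_seq big1 // => s sms; case: (eqVneq (killed_step Om w k (a * s)%g) 0).
    by move=> ->; rewrite mulr0.
  by move=> s0; case: none; exists s.
have [v [v0 vk vr vO]] := IHk _ s0.
exists (fun l => if l is l'.+1 then v l' else a); split=> //.
- by case=> [_|l]; [rewrite v0 dist_mulr range|exact: vr].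
- by case=> [_|l]; [|exact: vO].
Qed.

(** Walks entering the ball of radius [t] around [q] are dominated by [h]. By [path_near_product]
    and the last hypothesis, walks avoiding it take at least [2 ^ j] steps and contribute a
    geometric tail. *)
Lemma green_pull q t j x z (h : Gamma -> R) :
  (forall b, 0 <= h b) -> (forall b, P h b <= h b) ->
  (forall b, (d q b <= t)%N -> G b z <= h b) ->
  (d x q + d z q + j * D + 2 * r < 2 * t + d x z)%N ->
  G x z <= h x + C / e ^+ d x z * (lam ^+ (2 ^ j) / (1 - lam)).
Proof.
move=> h0 Ph hball avoid; apply: (green_le geod tw) => n.
pose Om b := (t < d q b)%N.
apply: le_trans (green_sum_le_killed (Om := Om) h0 Ph _) _.
  by move=> b; rewrite /Om -leqNgt => /hball.
rewrite lerD2l killed_sum.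
apply: (@le_trans _ _ (\sum_(0 <= k < n | true && (2 ^ j <= k)%N)
    C / e ^+ d x z * lam ^+ k)); last first.
  rewrite -(big_nat_widenl _ 0) // -mulr_sumr ler_wpM2l //; last exact: (geometric_sum_le tw).
  by rewrite divr_ge0 ?exprn_ge0 ?ltW.
rewrite [leRHS]big_mkcond; apply: ler_sum => k _ /=; case: leqP => kj.
  apply: le_trans (killed_step_le _ _ _ _) _; apply: (nstep_le_decay geod tw) => //.
case: (eqVneq (killed_step Om z k x) 0) => [-> //|].
move=> /killed_step_path[v [v0 vk vr vO]].
have [|l lk] := path_near_product geod hyp (r := r) q (v := v) (i := 0) (ltnW kj).
  by move=> l; exact: vr.
rewrite add0n in lk *; have := vO l; rewrite v0 vk /Om (distC geod q).
by move=> /(_ ltac:(lia)); lia.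
Qed.

End GreenPotential.

(** * Ancona's inequality *)

Section Shadow.
Variables (Gamma : groupType) (len : Gamma -> nat) (D : nat).
Hypothesis geod : geodesic_length len.
Hypothesis hyp : four_point len D.
Local Notation d := (dist len).
Local Open Scope nat_scope.

(* The barriers of Ancona's inequality: as [R] decreases, balls around the point
   at distance [R] from [p] towards [x0], preceded by [x0] itself while it is
   closer than that. *)
Definition shadow p x0 R s x :=
  (x = x0 /\ d p x0 <= R) \/
  exists2 x', d p x' + d x' x0 = d p x0 & d p x' = R /\ d x' x <= s.

Lemma shadow_dist p x0 R s x : shadow p x0 R s x -> d p x <= R + s.
Proof.
case=> [[->] ?|[x' _ [pR x's]]]; first by lia.
by have := dist_triangle geod x' p x; lia.
Qed.

(** The first case is [x = x0] within [R] of [p]. Otherwise [q] lies at distance [R] from [p]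
    towards [x']; the balls around [x'] and [z'] are small compared with their distances to [q], so
    replacing these centres by [x] and [z] costs [D] each. *)
Lemma shadow_barrier kappa p x0 z0 R s Rz sz x z :
  d p x0 + d p z0 <= d x0 z0 + kappa ->
  8 * s <= R -> 8 * sz <= Rz -> kappa + D < s -> s <= sz ->
  shadow p x0 (2 * R) (2 * s) x -> shadow p z0 Rz sz z ->
  shadow p x0 R s x \/
  exists2 q, forall b, d q b <= s -> shadow p x0 R s b &
    d x q + d z q <= d x z + kappa + 2 * D.
Proof.
move=> xz sR szR ks ssz Sx Sz; have tri := dist_triangle geod; have sym := distC geod.
have [x' [px' x'P]] : exists x', d p x' + d x' x0 = d p x0 /\
    ((x = x' /\ x = x0) /\ d p x' <= 2 * R \/ d p x' = 2 * R /\ d x' x <= 2 * s).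
  case: Sx => [[-> le]|[x' ? ?]]; first by exists x0; rewrite distxx // addn0; split=> //; left.
  by exists x'; split=> //; right.
have [z' [pz' z'P]] : exists z', d p z' + d z' z0 = d p z0 /\
    (z = z' \/ d p z' = Rz /\ d z' z <= sz).
  case: Sz => [[-> le]|[z' ? ?]]; first by exists z0; rewrite distxx // addn0; split=> //; left.
  by exists z'; split=> //; right.
case: (leqP (d p x') R) => [px'R|Rpx'].
  case: x'P => [[[xx' xx0] _]|[]]; last by lia.
  by left; left; split=> //; rewrite -xx0 xx'.
right; have [|q [pq qx']] := geodesic_point geod (x := p) (y := x') (k := R); first by lia.
have qx0 : d p q + d q x0 = d p x0.
  by have := tri x' q x0; have := tri q p x0; lia.
exists q; first by move=> b qb; right; exists q.
have x'z' : d p x' + d p z' <= d x' z' + kappa.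
  by have := tri x' x0 z0; have := tri z' x' z0; rewrite (sym x0 x'); lia.
have qz' : d q z' <= R + d p z' by have := tri p q z'; rewrite (sym q p); lia.
have qz'2 : R + d p z' <= d q z' + kappa.
  by have := tri q x' z'; rewrite (sym x' q); lia.
have xz' : d x q + d q z' <= d x z' + kappa + D.
  case: x'P => [[[-> _] _]|[px'R x'x]]; first by rewrite (sym x' q); lia.
  have := tri x x' q; rewrite (sym x' q) => T.
  by case: (four_pointP hyp x x' q z') => H;
    rewrite ?(sym x x') ?(sym q z') ?(sym x' q) ?(sym z' q) in H *; lia.
case: z'P => [->|[pz'R z'z]]; first by rewrite (sym z' q); lia.
have T := tri z z' q.
case: (four_pointP hyp z z' q x) => H;
  rewrite ?(sym z z') ?(sym q x) ?(sym z x) ?(sym z' x) ?(sym z' q) in H T *; lia.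
Qed.

End Shadow.

Record hyperbolic_walk (R : realType) (Gamma : groupType) (len : Gamma -> nat)
    (D : nat) (mu : Gamma -> R) (ms : seq Gamma) (r : nat) (C lam e : R) : Prop := {
  hw_geod : geodesic_length len;
  hw_hyp : four_point len D;
  hw_walk : transient_walk len mu ms C lam;
  hw_e : 0 < e <= 1;
  hw_harnack : forall x y, exists n, e ^+ dist len x y <= nstep mu n x y;
  hw_range : forall s, s \in ms -> (len s <= r)%N }.

Lemma hyperbolic_walk_reversed (R : realType) (Gamma : groupType)
    (len : Gamma -> nat) (D : nat) (mu : Gamma -> R) ms r C lam e :
  hyperbolic_walk len D mu ms r C lam e ->
  hyperbolic_walk len D (reversed_walk mu) [seq (s^-1)%g | s <- ms] r C lam e.
Proof.
move=> [geod hyp tw e01 harnack range]; split=> //.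
- exact: transient_reversed.
- move=> x y; have [n en] := harnack y x; exists n.
  by rewrite (nstep_reversed tw) (distC geod).
- by move=> _ /mapP[s sms ->]; rewrite (geod_lenV geod) range.
Qed.

Lemma exp_small (R : realType) (lam A : R) : 0 < lam < 1 -> 0 < A ->
  exists n0, forall n, (n0 <= n)%N -> lam ^+ n * A <= 1.
Proof.
move=> /andP[lam0 lam1] A0; pose t := lam^-1 - 1.
have t0 : 0 < t by rewrite subr_gt0 invf_gt1.
exists (Num.truncn (A / t)).+1 => n n0n.
have ln0 : 0 < lam ^+ n by rewrite exprn_gt0.
rewrite mulrC -ler_pdivlMr // mul1r -exprVn (_ : lam^-1 = 1 + t); last by rewrite /t; lra.
apply: le_trans (bernoulli_le n (ltW t0)).
have : A / t < n%:R by apply: lt_le_trans (truncnS_gt _) _; rewrite ler_nat.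
by rewrite ltr_pdivrMr //; lra.
Qed.

(** Writing [k = 2 * m + i] gives [2 ^ k >= (m + 1) ^ 2], because [2 ^ m > m]. *)
Lemma exp2_ge_affine (A B k : nat) : (2 * (A + 2 * B) <= k)%N -> (A + B * k <= 2 ^ k)%N.
Proof.
move=> le; have [m [i km]] : exists m i, (k = m + m + i /\ i <= 1)%N.
  by exists k./2, (odd k); split; [rewrite addnn addnC odd_double_half|case: (odd k)].
have e2 : (2 ^ k = 2 ^ m * 2 ^ m * 2 ^ i)%N by case: km => -> _; rewrite !expnD.
have := ltn_expl m (ltnSn 1); have : (0 < 2 ^ i)%N by rewrite expn_gt0.
rewrite e2; move: (2 ^ m)%N (2 ^ i)%N => u v v0 mu.
have : (m.+1 * m.+1 <= u * u * v)%N by nia.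
by apply: leq_trans; nia.
Qed.

Section Ancona.
Variables (R : realType) (Gamma : groupType) (len : Gamma -> nat) (D r : nat).
Variables (C lam e : R).
Implicit Types (mu : Gamma -> R) (ms : seq Gamma) (x y z p q b : Gamma).
Local Notation d := (dist len).
Local Notation hwalk mu ms := (hyperbolic_walk len D mu ms r C lam e).
Local Notation G mu := (greenr mu).

(** The product [M * G b p * G p z] is superharmonic in [b], hence an admissible [h] in
    [green_pull]. *)
Lemma green_pull_left mu ms q t j x z p (M : R) : hwalk mu ms -> 0 <= M ->
  (forall b, (d q b <= t)%N -> G mu b z <= M * G mu b p * G mu p z) ->
  (d x q + d z q + j * D + 2 * r < 2 * t + d x z)%N ->
  G mu x z <= M * G mu x p * G mu p z + C / e ^+ d x z * (lam ^+ (2 ^ j) / (1 - lam)).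
Proof.
move=> [geod hyp tw e01 harnack range] M0 Hb avoid.
have g0 := green_ge0 geod tw.
apply: (green_pull geod hyp tw e01 harnack range
   (h := fun b => M * G mu b p * G mu p z)) avoid => [b|b|//].
  by rewrite !mulr_ge0.
have -> : (fun b => M * G mu b p * G mu p z) = (fun b => (M * G mu p z) * G mu b p).
  by apply/funext => a; rewrite mulrAC.
rewrite markov_opZ [leRHS]mulrAC ler_wpM2l ?mulr_ge0 //.
exact: (green_superharmonic geod tw).
Qed.

Lemma green_pull_right mu ms q t j x z p (M : R) : hwalk mu ms -> 0 <= M ->
  (forall b, (d q b <= t)%N -> G mu x b <= M * G mu x p * G mu p b) ->
  (d x q + d z q + j * D + 2 * r < 2 * t + d x z)%N ->
  G mu x z <= M * G mu x p * G mu p z + C / e ^+ d x z * (lam ^+ (2 ^ j) / (1 - lam)).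
Proof.
move=> hw M0 Hb avoid; have geod := hw_geod hw; have tw := hw_walk hw.
have := green_pull_left (q := q) (t := t) (j := j) (x := z) (z := x) (p := p)
  (hyperbolic_walk_reversed hw) M0.
rewrite !(green_reversed tw) (distC geod z x) mulrAC; apply.
  by move=> b qb; rewrite !(green_reversed tw) mulrAC; exact: Hb.
by rewrite addnC [X in (_ + X < _)%N]addnC in avoid *; lia.
Qed.

(** The conditions for a barrier of radius [2 ^ k] with [j = 2 * k]: it exceeds the alignment
    errors, walks around it need [2 ^ (2 * k)] steps, and these are negligible. In the exponent 72,
    one half serves for [d x z] and the other for the lower bound of [G x p * G p z]. *)
Lemma barrier_scale (kappa : nat) : 0 < C -> 0 < lam < 1 -> 0 < e <= 1 ->
  exists k0, forall k, (k0 <= k)%N ->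
    [/\ (kappa + D < 2 ^ k)%N,
        (kappa + 2 * D + 2 * k * D + 2 * r < 2 * 2 ^ k)%N &
        lam ^+ (2 ^ (2 * k)) / (1 - lam) * C <= e ^+ (72 * 2 ^ k) / 2 ^+ k].
Proof.
move=> C0 lam01 /andP[e0 e1]; have /andP[lam0 lam1] := lam01.
(* The inequality [lam ^+ (2 ^ k) * (2 * K) <= e ^+ 72] will be raised to the power [2 ^ k]. Then
   [2 ^+ (2 ^ k)] pays for [2 ^+ k], and [K ^+ (2 ^ k)] for [C / (1 - lam)] because [K >= 1]. *)
pose K := C / (1 - lam) + 1.
have K1 : 1 <= K by rewrite lerDr divr_ge0 ?ltW // subr_gt0.
have A0 : 0 < 2 * K / e ^+ 72 by rewrite divr_gt0 ?exprn_gt0 //; lra.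
have [n0 n0P] := exp_small lam01 A0.
exists (n0 + 2 * ((kappa + 2 * D + 2 * r).+1 + 2 * (2 * D)))%N => k kP.
have := @exp2_ge_affine (kappa + 2 * D + 2 * r).+1 (2 * D) k.
move=> /(_ ltac:(lia)) big; split; [lia|lia|].
have n0k : (n0 <= 2 ^ k)%N by apply: leq_trans (ltnW (ltn_expl k (ltnSn 1))); lia.
have := n0P _ n0k; rewrite mulrA ler_pdivrMr ?exprn_gt0 // mul1r => small.
have : (lam ^+ (2 ^ k) * (2 * K)) ^+ (2 ^ k) <= (e ^+ 72) ^+ (2 ^ k).
  by rewrite lerXn2r // nnegrE ?mulr_ge0 ?exprn_ge0 ?ltW //; lra.
rewrite [leLHS]exprMn [(2 * K) ^+ _]exprMn -!exprM -expnD addnn -mul2n => H.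
rewrite ler_pdivlMr ?exprn_gt0 //; apply: le_trans H.
rewrite -!mulrA ler_wpM2l ?exprn_ge0 ?(ltW lam0) //.
have two : 2 ^+ k <= 2 ^+ (2 ^ k) :> R.
  by apply: ler_weXn2l; [rewrite ler1n|exact: ltnW (ltn_expl k (ltnSn 1))].
have KK : K <= K ^+ (2 ^ k) by rewrite ler_eXnr // expn_gt0.
rewrite mulrA [leLHS]mulrC ler_pM ?exprn_ge0 //.
  by rewrite mulr_ge0 // ?invr_ge0 ltW // subr_gt0.
by apply: le_trans KK; rewrite /K mulrC lerDl.
Qed.

(** Induction over the scales [k = k0 + i], for [x] and [z] in shadows of radius [2 ^ k] and with
    constant [M k]. From scale [k.+1], first [x] and then [z] is pulled to the barrier of scale [k],
    each at a relative cost [(2 ^+ k)^-1]. *)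
Theorem ancona_inequality mu ms (kappa : nat) : hwalk mu ms ->
  exists2 A : R, 1 <= A & forall x z p, (d p x + d p z <= d x z + kappa)%N ->
    G mu x z <= A * G mu x p * G mu p z.
Proof.
move=> hw; have [geod hyp tw e01 harnack range] := hw; have /andP[e0 e1] := e01.
have [k0 k0P] := barrier_scale kappa (tw_C tw) (tw_lam tw) e01.
have lowG := green_lower geod tw e01 harnack.
have harnackl := green_harnackl geod tw harnack.
have g0 := green_ge0 geod tw.
(* At the smallest scale both points are within [9 * 2 ^ k0] of [p], and Harnack's inequality
   suffices. *)
pose M0 := (e ^+ (18 * 2 ^ k0))^-1.
have M00 : 1 <= M0 by rewrite invf_ge1 ?exprn_gt0 // exprn_ile1 // ltW.
exists (M0 + 4) => [|x0 z0 p gp]; first lra.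
(* Here [M k.+1 = M k + 2 * (2 ^+ k)^-1], one error for each end, and the total stays below
   [M0 + 4]. *)
pose M k : R := M0 + 4 * (1 - (2 ^+ k)^-1).
have MM k : 0 <= M k /\ M k <= M0 + 4.
  have : 0 <= (2 ^+ k)^-1 :> R by rewrite invr_ge0 exprn_ge0.
  have : (2 ^+ k)^-1 <= 1 :> R by rewrite invf_le1 ?exprn_gt0 // exprn_ege1 // ler1n.
  by rewrite /M; split; lra.
have error k x z : (k0 <= k)%N -> (d p x <= 18 * 2 ^ k)%N -> (d p z <= 18 * 2 ^ k)%N ->
    C / e ^+ d x z * (lam ^+ (2 ^ (2 * k)) / (1 - lam)) <=
    (2 ^+ k)^-1 * G mu x p * G mu p z.
  move=> /k0P[_ _ scale] px pz.
  have low : e ^+ (36 * 2 ^ k) <= G mu x p * G mu p z.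
    rewrite (_ : 36 * 2 ^ k = 18 * 2 ^ k + 18 * 2 ^ k)%N; last by lia.
    rewrite exprD; apply: ler_pM; rewrite ?exprn_ge0 ?(ltW e0) //.
      by apply: le_trans (lowG x p); rewrite ler_wiXn2l ?(ltW e0) // (distC geod).
    by apply: le_trans (lowG p z); rewrite ler_wiXn2l ?(ltW e0).
  rewrite -[leRHS]mulrA; apply: (@le_trans _ _ ((2 ^+ k)^-1 * e ^+ (36 * 2 ^ k))); last first.
    by rewrite ler_wpM2l // invr_ge0 exprn_ge0.
  rewrite mulrAC ler_pdivrMr ?exprn_gt0 // [leLHS]mulrC; apply: le_trans scale _.
  rewrite -[leRHS]mulrA [leRHS]mulrC ler_wpM2r ?invr_ge0 ?exprn_ge0 //.
  rewrite -exprD ler_wiXn2l ?(ltW e0) //.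
  by have := dist_triangle geod p x z; rewrite (distC geod x p); lia.
pose Sx k := shadow len p x0 (8 * 2 ^ k) (2 ^ k).
pose Sz k := shadow len p z0 (8 * 2 ^ k) (2 ^ k).
have dist2 (a b c c' : R) : (a + b) * c * c' = a * c * c' + b * c * c' by ring.
have main i x z : Sx (k0 + i)%N x -> Sz (k0 + i)%N z ->
    G mu x z <= M (k0 + i)%N * G mu x p * G mu p z.
  elim: i x z => [|i IHi] x z.
    rewrite addn0 => /(shadow_dist geod) px /(shadow_dist geod) pz.
    have MM0 : M0 <= M k0.
      by rewrite /M lerDl mulr_ge0 // subr_ge0 invf_le1 ?exprn_gt0 // exprn_ege1 // ler1n.
    have H1 := harnackl p x z; have H2 := lowG x p.
    have e18 : e ^+ (18 * 2 ^ k0) <= e ^+ d p x * e ^+ d p x.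
      by rewrite -exprD ler_wiXn2l ?(ltW e0) //; lia.
    rewrite -[leRHS]mulrA; apply: (@le_trans _ _ (M0 * (G mu x p * G mu p z))); last first.
      by rewrite ler_wpM2r // mulr_ge0.
    rewrite ler_pdivlMl ?exprn_gt0 //.
    apply: le_trans (ler_wpM2r (g0 _ _) e18) _; rewrite -mulrA.
    by rewrite (distC geod x p) in H2; apply: ler_pM; rewrite ?mulr_ge0 ?exprn_ge0 ?(ltW e0).
  set k := (k0 + i)%N in IHi *; have k0k : (k0 <= k)%N by rewrite leq_addr.
  have [kD avoid _] := k0P k k0k; have ek : (k0 + i.+1 = k.+1)%N by rewrite addnS.
  have [Mk0 _] := MM k.
  have eR : (8 * 2 ^ k.+1 = 2 * (8 * 2 ^ k))%N by rewrite expnS; lia.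
  have left x' z' : Sx k.+1 x' -> Sz k z' ->
      G mu x' z' <= (M k + (2 ^+ k)^-1) * G mu x' p * G mu p z'.
    move=> Sx' Sz'; have px := shadow_dist geod Sx'; have pz := shadow_dist geod Sz'.
    have err0 : 0 <= (2 ^+ k)^-1 * G mu x' p * G mu p z'.
      by rewrite !mulr_ge0 // invr_ge0 exprn_ge0.
    rewrite /Sx eR expnS in Sx'; rewrite dist2.
    have [|||Sxk|[q qb qxz]] := shadow_barrier geod hyp gp _ _ kD _ Sx' Sz'; try lia.
      by apply: le_trans (IHi _ _ Sxk Sz') _; rewrite lerDl.
    apply: le_trans (@green_pull_left _ _ q (2 ^ k) (2 * k) x' z' p _ hw Mk0 _ _) _.
    - by move=> b /qb /IHi; apply.
    - lia.
    - rewrite lerD2l; apply: error => //; last by lia.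
      by move: px; rewrite expnS; lia.
  rewrite ek => Sx' Sz'; have px := shadow_dist geod Sx'; have pz := shadow_dist geod Sz'.
  have Mk1 : M k.+1 = M k + (2 ^+ k)^-1 + (2 ^+ k)^-1.
    by rewrite /M exprS invfM; lra.
  have err0 : 0 <= (2 ^+ k)^-1 * G mu x p * G mu p z.
    by rewrite !mulr_ge0 // invr_ge0 exprn_ge0.
  have gp' : (d p z0 + d p x0 <= d z0 x0 + kappa)%N by rewrite addnC (distC geod z0).
  rewrite Mk1 dist2; have Sz'' := Sz'; rewrite /Sz eR expnS in Sz''.
  have [|||Szk|[q qb qxz]] :=
    shadow_barrier geod hyp gp' _ _ kD _ Sz'' Sx'; try (rewrite ?expnS; lia).
    by apply: le_trans (left _ _ Sx' Szk) _; rewrite lerDl.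
  apply: le_trans (@green_pull_right _ _ q (2 ^ k) (2 * k) x z p (M k + (2 ^+ k)^-1) hw _ _ _) _.
  - by rewrite addr_ge0 // invr_ge0 exprn_ge0.
  - by move=> b /qb; exact: left.
  - by rewrite (distC geod z x) in qxz; lia.
  - rewrite lerD2l; apply: error => //; first by move: px; rewrite expnS; lia.
    by move: pz; rewrite expnS; lia.
(* At this scale [x0] and [z0] belong to their own shadows, by the first clause of [shadow]. *)
have [i iE] : exists i, i = (d p x0 + d p z0)%N by eexists.
have big : (i <= 8 * 2 ^ (k0 + i))%N.
  apply: leq_trans (ltnW (ltn_expl i (ltnSn 1))) _; rewrite expnD.
  by have : (0 < 2 ^ k0)%N; [rewrite expn_gt0|nia].
have := main i x0 z0; move=> /(_ _ _) H; apply: le_trans (H _ _) _.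
- by left; split=> //; lia.
- by left; split=> //; lia.
- by rewrite -[leLHS]mulrA -[leRHS]mulrA ler_wpM2r ?mulr_ge0 //; case: (MM (k0 + i)%N).
Qed.

End Ancona.

(** * Hoelder continuity on the group *)

Lemma abs_diff_le (R : realType) (a b c : R) :
  0 <= a <= c -> 0 <= b <= c -> `|a - b| <= c.
Proof. by move=> /andP[a0 ac] /andP[b0 bc]; rewrite ler_norml; lra. Qed.

(** Bernoulli's inequality for [t = 1 - (1 - s) / h]. *)
Lemma exists_root_ge (R : realType) (s : R) (h : nat) : 0 < s < 1 -> (0 < h)%N ->
  exists2 t : R, 0 < t < 1 & s <= t ^+ h.
Proof.
move=> /andP[s0 s1] h0; pose a := (1 - s) / h%:R.
have hR : 1 <= h%:R :> R by rewrite ler1n.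
have ha : h%:R * a = 1 - s by rewrite mulrC mulfVK // gt_eqF // ltr0n.
have /andP[a0 a1] : 0 < a <= 1 - s.
  by rewrite divr_gt0 ?subr_gt0 ?ltr0n //= ler_pdivrMr ?ltr0n // ler_peMr ?subr_ge0 // ltW.
have t0 : 0 <= 1 - a by lra.
exists (1 - a); first by apply/andP; split; lra.
suff bern n : 1 - n%:R * a <= (1 - a) ^+ n by have := bern h; rewrite ha; lra.
elim: n => [|n IHn]; first by rewrite mul0r subr0.
rewrite exprS; apply: le_trans (ler_wpM2l t0 IHn).
have : 0 <= n%:R * a ^+ 2 by rewrite mulr_ge0 // sqr_ge0.
by rewrite -natr1; lra.
Qed.

Section Holder.
Variables (R : realType) (Gamma : groupType) (len : Gamma -> nat) (D r : nat).
Variables (mu : Gamma -> R) (ms : seq Gamma) (C lam e : R).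
Hypothesis hw : hyperbolic_walk len D mu ms r C lam e.
Implicit Types (x y w a b g : Gamma).
Local Notation d := (dist len).
Local Notation G := (greenr mu).
Local Notation P := (markov_op mu ms).
Let geod := hw_geod hw.
Let hyp := hw_hyp hw.
Let tw := hw_walk hw.
Let e01 := hw_e hw.
Let harnack := hw_harnack hw.
Let range := hw_range hw.
Let walk := tw_walk tw.
Let g0 : forall x y, 0 < G x y := green_gt0 geod tw e01 harnack.

(* The points [a] with [(a|x) < T]. *)
Definition behind x T a := (len a + len x < d a x + 2 * T)%N.

(** The point [w] lies at height [W] on a geodesic from [1] to [x]. Geodesics from [1] to [b] pass
    near [w], while those from [1] to [a] turn off well before; so a geodesic from [a] to [b] comes
    near [w]. *)
Lemma behind_separation x w a b (W N : nat) :
  len w = W -> (W + d w x)%N = len x -> (2 * D <= W)%N ->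
  (len a + len x < d a x + 2 * (W - 2 * D))%N ->
  (d b x + 2 * (W + N) <= len b + len x)%N ->
  (d w a + d w b <= d a b + 2 * D)%N /\ (N <= d w b)%N.
Proof.
move=> wW wx DW Ha Hb; have tri := dist_triangle geod; have sym := distC geod.
have d1 := dist1 len; have d1' c : d c 1%g = len c by rewrite sym d1.
have bW : (d w b + W <= len b + D)%N.
  by case: (four_pointP hyp 1%g b x w) => H; rewrite !d1 (sym b w) ?(sym x w) in H; lia.
have T1 := tri b x 1%g; rewrite !d1' (sym x b) in T1.
have T2 := tri w 1%g b; rewrite !d1 wW in T2.
split; last by lia.
have aW : (len a + 2 * D < d w a + W)%N.
  rewrite ltnNge; apply/negP => le.
  by case: (four_pointP hyp a w x 1%g) => H; rewrite !d1' ?wW ?(sym a w) in H; lia.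
by case: (four_pointP hyp a b w 1%g) => H; rewrite !d1' ?(sym a w) ?(sym b w) in H; lia.
Qed.

Lemma green_conv_small (eps : R) : 0 < eps -> exists2 N, (0 < N)%N & forall w (B : seq Gamma),
  uniq B -> (forall b, b \in B -> (N <= d w b)%N) ->
  \sum_(b <- B) G w b * G b w <= eps.
Proof.
move=> eps0; have l1 : 0 < 1 - lam by rewrite subr_gt0; case/andP: (tw_lam tw).
have A0 : 0 < C / (1 - lam) ^+ 2 / eps by rewrite !divr_gt0 ?exprn_gt0 // (tw_C tw).
have [k kP] := exp_small (tw_lam tw) A0.
exists (r * k).+1 => // w B Buniq BN; apply: le_trans (green_conv_tail geod tw (k := k) Buniq _) _.
  move=> b n bB nk; apply: (nstep_out geod tw e01 range).
  by apply: leq_trans (BN b bB); rewrite ltnS leq_mul2l (ltnW nk) orbT.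
by have := kP k (leqnn k); rewrite mulrA ler_pdivrMr // mul1r mulrC.
Qed.

Section Oscillation.
Variables (A : R) (N : nat).
Hypothesis A1 : 1 <= A.
Hypothesis N_gt0 : (0 < N)%N.
Hypothesis ancona : forall x z p, (d p x + d p z <= d x z + 2 * D)%N ->
  G x z <= A * G x p * G p z.
Hypothesis small_tail : forall w (B : seq Gamma), uniq B ->
  (forall b, b \in B -> (N <= d w b)%N) -> \sum_(b <- B) G w b * G b w <= (2 * A)^-1.

(** [2 * D] for the alignment at [w], [N] for the small tail, [r] for the step that crosses the
    boundary. *)
Let gap := (2 * D + r + N)%N.
Let G0 := G 1%g 1%g.
Let G01 : 1 <= G0 := green_diag_ge1 geod tw 1%g.
Let eta := (2 * A * G0)^-1.

(** At least half of [G a w] comes from visits to [w] before leaving [Om]: exits at [b] account for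
    at most the sum of [G a b * G b w <= A * G a w * G w b * G b w], which [small_tail] bounds by
    [G a w / 2]. The domination principle then brings in [f]. *)
Lemma behind_minorization x w T (f : Gamma -> R) a :
  len w = (T + 2 * D)%N -> (len w + d w x)%N = len x ->
  (forall b, behind x (gap + T) b -> 0 <= f b) ->
  (forall b, behind x (2 * D + N + T) b -> P f b <= f b) ->
  0 <= f w -> behind x T a -> G a w * f w <= 2 * G0 * f a.
Proof.
move=> wT wx f0 Pf fw Ha; have tri := dist_triangle geod.
have fa : 0 <= f a by apply: f0; move: Ha; rewrite /behind /gap; lia.
suff key n : (green_sum mu n a w - G a w / 2) * f w <= G0 * f a.
  have [fw0|fw0] := eqVneq (f w) 0.
    by rewrite fw0 mulr0 !mulr_ge0 // (le_trans ler01).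
  have fwp : 0 < f w by rewrite lt0r fw0.
  have : G a w <= G a w / 2 + G0 * f a / f w.
    apply: (green_le geod tw) => n.
    by rewrite addrC -lerBlDr ler_pdivlMr.
  rewrite -lerBlDl ler_pdivlMr //; lra.
pose Om := behind x (2 * D + N + T).
(* Exit points reachable in [n] steps: a finite list, and the bound on [h a] below is independent of
   [n]. *)
pose far := [seq b <- [seq (a * z)%g | z <- lball geod (r * n)] | ~~ Om b].
have far_uniq : uniq far.
  by rewrite filter_uniq // (map_inj_uniq (mulgI a)) lball_uniq.
have farP b : b \in far -> (d w a + d w b <= d a b + 2 * D)%N /\ (N <= d w b)%N.
  rewrite mem_filter => /andP[nOb _].
  apply: (behind_separation (x := x) wT); rewrite ?leq_addl ?addnK -?wT //.
  move: nOb; rewrite /Om /behind wT -leqNgt.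
  by move: (len b) (len x) (d b x) => i j l; clear; lia.
pose h a' := \sum_(b <- far) G a' b * G b w.
have kill : green_sum mu n a w <= h a + killed mu ms Om w n a.
  apply: (green_sum_le_killed geod tw range) => [b|b|b nOb ab].
  - by apply: sumr_ge0 => c _; rewrite mulr_ge0 // ltW.
  - rewrite markov_op_sum; apply: ler_sum => c _.
    have -> : (fun y => G y c * G c w) = (fun y => G c w * G y c).
      by apply/funext => y; rewrite mulrC.
    by rewrite markov_opZ mulrC ler_wpM2r ?(ltW (g0 _ _)) // (green_superharmonic geod tw).
  have bfar : b \in far.
    rewrite mem_filter nOb /=; apply/mapP; exists (a^-1 * b)%g; last by rewrite mulVKg.
    by rewrite mem_lball.
  rewrite /h (bigD1_seq b) //=; apply: ler_wpDr.
    by apply: sumr_ge0 => c _; rewrite mulr_ge0 // ltW.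
  by rewrite ler_peMl ?(ltW (g0 _ _)) // (green_diag_ge1 geod tw).
have A0 : 0 < A by exact: lt_le_trans ltr01 A1.
have ha : h a <= G a w / 2.
  apply: (@le_trans _ _ (\sum_(b <- far) (A * G a w) * (G w b * G b w))).
    rewrite /h big_seq [leRHS]big_seq; apply: ler_sum => b /farP[ab _].
    by rewrite mulrA ler_wpM2r ?(ltW (g0 _ _)) // ancona.
  rewrite -mulr_sumr; apply: (@le_trans _ _ (A * G a w * (2 * A)^-1)).
    rewrite ler_wpM2l ?mulr_ge0 ?(ltW A0) ?(ltW (g0 _ _)) //.
    by apply: small_tail => // b /farP[].
  have -> // : A * G a w * (2 * A)^-1 = G a w / 2.
  by field; rewrite gt_eqF.
apply: (@le_trans _ _ (killed mu ms Om w n a * f w)).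
  by rewrite ler_wpM2r //; lra.
rewrite /G0 -(green_diag tw w).
apply: (killed_le_superharmonic geod tw) => // b s Ob sms; apply: f0.
have := range sms; have := geod_lenM geod b s; have := tri (b * s)%g b x.
rewrite dist_mulr; move: Ob; rewrite /Om /behind /gap.
by move: (len _) (len s) (len b) (len x) (d _ x) (d b x) => i0 i1 i2 i3 i4 i5; clear; lia.
Qed.

Lemma green_harmonic_behind x y T a : (d y x + 2 * T <= len y + len x)%N ->
  behind x T a -> P (G ^~ y) a = G a y.
Proof.
move=> yT aT; rewrite [RHS](green_harmonic geod tw) (_ : a == y = false) ?add0r //.
by apply/eqP => ay; move: aT yT; rewrite ay /behind; lia.
Qed.

Lemma ancona_behind x T : (gap + T <= len x)%N ->
  exists w, [/\ len w = (T + 2 * D)%N, (len w + d w x)%N = len x &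
    forall z a, (d z x + 2 * (gap + T) <= len z + len x)%N -> behind x T a ->
      G a z <= A * G a w * G w z].
Proof.
move=> Tx; have [|w [lw wx]] := geodesic_point geod (x := 1%g) (y := x) (k := T + 2 * D).
  by rewrite dist1; rewrite /gap in Tx; lia.
rewrite !dist1 in lw wx; exists w; split=> //.
  by rewrite lw wx subnKC //; rewrite /gap in Tx; lia.
move=> z a zT Ha; apply: ancona.
have [||||//] := @behind_separation x w a z (T + 2 * D) N lw.
- by rewrite wx subnKC //; rewrite /gap in Tx; lia.
- by rewrite leq_addl.
- by rewrite addnK.
- by move: zT; rewrite /gap; lia.
Qed.

Let A0 : 0 < A. Proof. exact: lt_le_trans ltr01 A1. Qed.
Let G00 : 0 < G0. Proof. exact: lt_le_trans ltr01 G01. Qed.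

(** Both [G ^~ x - m * G ^~ y] and [M * G ^~ y - G ^~ x] are nonnegative and harmonic in the regions
    required by [behind_minorization]. With Ancona's inequality, each dominates [eta * G ^~ y] times
    its ratio to [G ^~ y] at [w]; the two ratios add up to [M - m]. *)
Lemma oscillation_contraction x y T (m M : R) :
  (gap + T <= len x)%N -> (d y x + 2 * (gap + T) <= len y + len x)%N ->
  (forall a, behind x (gap + T) a -> m * G a y <= G a x <= M * G a y) ->
  exists m' M', M' - m' = (1 - eta) * (M - m) /\
    forall a, behind x T a -> m' * G a y <= G a x <= M' * G a y.
Proof.
move=> Tx Ty bounds; have [w [lw wx anc]] := ancona_behind Tx.
have bw : behind x (gap + T) w by rewrite /behind /gap; lia.
have xT : (d x x + 2 * (2 * D + N + T) <= len x + len x)%N.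
  by rewrite (distxx geod); move: Tx; rewrite /gap; lia.
have yT : (d y x + 2 * (2 * D + N + T) <= len y + len x)%N.
  by move: Ty; rewrite /gap; lia.
have low (f : Gamma -> R) a : (forall b, behind x (gap + T) b -> 0 <= f b) ->
    (forall b, behind x (2 * D + N + T) b -> P f b <= f b) ->
    behind x T a -> eta * f w / G w y * G a y <= f a.
  move=> f0 Pf Ha; have fw := f0 w bw.
  have H1 := behind_minorization lw wx f0 Pf fw Ha.
  have H2 := anc y a Ty Ha.
  have Gw := g0 w y; rewrite mulrAC ler_pdivrMr // -[eta * f w * _]mulrA ler_pdivrMl; last first.
    by rewrite !mulr_gt0.
  apply: (@le_trans _ _ (f w * (A * G a w * G w y))); first by rewrite ler_wpM2l.
  have -> : f w * (A * G a w * G w y) = (A * G w y) * (G a w * f w) by ring.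
  have -> : 2 * A * G0 * (f a * G w y) = (A * G w y) * (2 * G0 * f a) by ring.
  by rewrite ler_wpM2l // mulr_ge0 // ltW.
pose rho := G w x / G w y; have rhoE : G w x = rho * G w y by rewrite mulfVK // gt_eqF.
exists (m + eta * (rho - m)), (M - eta * (M - rho)); split; first by ring.
move=> a Ha; apply/andP; split.
- suff : eta * (rho - m) * G a y <= G a x + - m * G a y by lra.
  have <- : eta * (G w x + - m * G w y) / G w y = eta * (rho - m).
    by rewrite rhoE; field; rewrite gt_eqF.
  apply: (low (fun b => G b x + - m * G b y)) => // b Hb.
    by have /andP[] := bounds b Hb; lra.
  rewrite markov_opD markov_opZ (green_harmonic_behind xT Hb).
  by rewrite (green_harmonic_behind yT Hb).
- suff : eta * (M - rho) * G a y <= M * G a y + - 1 * G a x by lra.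
  have <- : eta * (M * G w y + - 1 * G w x) / G w y = eta * (M - rho).
    by rewrite rhoE; field; rewrite gt_eqF.
  apply: (low (fun b => M * G b y + - 1 * G b x)) => // b Hb.
    by have /andP[] := bounds b Hb; lra.
  rewrite markov_opD !markov_opZ (green_harmonic_behind xT Hb).
  by rewrite (green_harmonic_behind yT Hb).
Qed.

(** Through [w], Ancona's inequality bounds [G a x] and [G 1 y] from above and [green_mul_le] bounds
    [G a y] and [G 1 x] from below; the factors involving [w] cancel. *)
Lemma ratio_bounded x y T : (0 < T)%N ->
  (gap + T <= len x)%N -> (d y x + 2 * (gap + T) <= len y + len x)%N ->
  forall a, behind x T a ->
    0 * G a y <= G a x <= (A * G0) ^+ 2 * (G 1%g x / G 1%g y) * G a y.
Proof.
move=> T0 Tx Ty a Ha; have [w [lw wx anc]] := ancona_behind Tx.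
rewrite mul0r ltW ?g0 //=.
have xT : (d x x + 2 * (gap + T) <= len x + len x)%N.
  by rewrite (distxx geod); move: Tx; lia.
have b1 : behind x T 1%g by rewrite /behind dist1 (geod_len1 geod); lia.
have H1 := anc x a xT Ha; have H2 := anc y 1%g Ty b1.
have mle b z : G b w * G w z <= G0 * G b z.
  by have := green_mul_le geod tw e01 harnack b w z; rewrite (green_diag tw).
have H3 := mle a y; have H4 := mle 1%g x.
rewrite mulrA mulrAC ler_pdivlMr //.
apply: (@le_trans _ _ (A * G a w * G w x * (A * G 1%g w * G w y))).
  by apply: ler_pM => //; exact: ltW.
have -> : A * G a w * G w x * (A * G 1%g w * G w y) =
  A ^+ 2 * ((G a w * G w y) * (G 1%g w * G w x)) by ring.
have -> : (A * G0) ^+ 2 * G 1%g x * G a y = A ^+ 2 * ((G0 * G a y) * (G0 * G 1%g x)) by ring.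
rewrite ler_wpM2l ?sqr_ge0 //; apply: ler_pM => //; by rewrite mulr_ge0 // ltW.
Qed.

Let eta01 : 0 < eta < 1.
Proof.
have AG : 1 <= A * G0 by rewrite mulr_ege1.
by rewrite /eta -mulrA; apply/andP; split; [rewrite invr_gt0|rewrite invf_lt1]; lra.
Qed.

Lemma oscillation_decay x y T k : (0 < T)%N ->
  (k.+1 * gap + T <= len x)%N -> (d y x + 2 * (k.+1 * gap + T) <= len y + len x)%N ->
  exists m M, M - m = (1 - eta) ^+ k * ((A * G0) ^+ 2 * (G 1%g x / G 1%g y)) /\
    forall a, behind x T a -> m * G a y <= G a x <= M * G a y.
Proof.
elim: k T => [|k IHk] T T0 Tx Ty.
  exists 0, ((A * G0) ^+ 2 * (G 1%g x / G 1%g y)); rewrite subr0 expr0 mul1r; split=> //.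
  by rewrite mul1n in Tx Ty; exact: ratio_bounded.
rewrite mulSn -addnA addnCA in Tx Ty.
have [|//|//|m [M [Mm bounds]]] := IHk (gap + T)%N; first by lia.
have [||m' [M' [Mm' bounds']]] := oscillation_contraction (x := x) (y := y) (T := T) _ _ bounds.
- by apply: leq_trans Tx; rewrite leq_addl.
- by lia.
by exists m', M'; rewrite Mm' Mm mulrA -exprS.
Qed.

(** With [T = (len g).+1] both [1] and [g] are behind [T], so the ratios at these two points lie in
    the same short interval. *)
Lemma martin_difference x y g k :
  (d y x + 2 * (k.+1 * gap + (len g).+1) <= len y + len x)%N ->
  `|G g x / G 1%g x - G g y / G 1%g y| <= (1 - eta) ^+ k * ((A * G0) ^+ 2 / e ^+ len g).
Proof.
move=> Ty; have Tx : (k.+1 * gap + (len g).+1 <= len x)%N.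
  by have := dist_triangle geod x 1%g y; rewrite !dist1 (distC geod x); lia.
have [//|m [M [Mm bounds]]] := oscillation_decay _ Tx Ty.
have b1 : behind x (len g).+1 1%g.
  by rewrite /behind dist1 (geod_len1 geod) add0n -addn1 leq_add2l.
have bg : behind x (len g).+1 g.
  have := dist_triangle geod g 1%g x; rewrite /behind !dist1.
  by move: (len g) (len x) (d g x) => i j l; clear; lia.
have gx := g0 g x; have gy := g0 g y; have ox := g0 1%g x; have oy := g0 1%g y.
set a := G g x / G g y; set b := G 1%g x / G 1%g y in Mm.
have between c : behind x (len g).+1 c -> m <= G c x / G c y <= M.
  by move=> /bounds; rewrite ler_pdivlMr // ler_pdivrMr.
have /andP[g1 g2] : m <= a <= M by exact: between.
have /andP[b1' b2] : m <= b <= M by exact: between.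
have ab : `|a - b| <= M - m by rewrite ler_norml; lra.
have -> : G g x / G 1%g x - G g y / G 1%g y = G g y / G 1%g x * (a - b).
  by rewrite /a /b; field; rewrite !gt_eqF.
have q0 : 0 <= G g y / G 1%g x by rewrite divr_ge0 // ltW.
rewrite normrM (ger0_norm q0); apply: le_trans (ler_wpM2l q0 ab) _.
have -> : G g y / G 1%g x * (M - m) = (1 - eta) ^+ k * ((A * G0) ^+ 2 * (G g y / G 1%g y)).
  by rewrite Mm /b; field; rewrite !gt_eqF.
rewrite ler_wpM2l //; last first.
  rewrite ler_wpM2l ?sqr_ge0 // ler_pdivrMr // ler_pdivlMl ?exprn_gt0 //.
    by have := green_harnackl geod tw harnack 1%g g y; rewrite dist1.
  by case/andP: e01.
by rewrite exprn_ge0 // subr_ge0; case/andP: eta01 => _ /ltW.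
Qed.

End Oscillation.

Theorem martin_holder_nat : exists2 s : R, 0 < s < 1 &
  forall g, exists2 H : R, 0 <= H & forall x y n,
    (d y x + 2 * n <= len y + len x)%N ->
    `|G g x / G 1%g x - G g y / G 1%g y| <= H * s ^+ n.
Proof.
have [A A1 anc] := ancona_inequality (2 * D) hw.
have A0 : 0 < A by exact: lt_le_trans ltr01 A1.
have [|N N0 tail] := @green_conv_small (2 * A)^-1; first by rewrite invr_gt0; lra.
pose h := (2 * D + r + N)%N; have h0 : (0 < h)%N by rewrite /h; lia.
pose eta := (2 * A * G 1%g 1%g)^-1.
have /andP[eta0 eta1] : 0 < eta < 1.
  have AG : 1 <= A * G 1%g 1%g by rewrite mulr_ege1 // (green_diag_ge1 geod tw).
  by rewrite /eta -mulrA; apply/andP; split; [rewrite invr_gt0|rewrite invf_lt1]; lra.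
have [|s /andP[s0 s1] sP] := @exists_root_ge R (1 - eta) h _ h0.
  by rewrite subr_gt0 eta1 gtrBl.
exists s; first by rewrite s0.
move=> g; pose c := ((len g).+1 + 2 * h)%N.
have e0 : 0 < e by case/andP: e01.
pose B := ((A * G 1%g 1%g) ^+ 2 + 1) / e ^+ len g.
have B0 : 0 <= B by rewrite divr_ge0 ?exprn_ge0 ?(ltW e0) // addr_ge0 // sqr_ge0.
exists (B / s ^+ c) => [|x y n Hn]; first by rewrite divr_ge0 // exprn_ge0 // ltW.
have sc : 0 < s ^+ c by rewrite exprn_gt0.
rewrite mulrAC ler_pdivlMr //.
have eg : 0 < e ^+ len g by rewrite exprn_gt0.
have AG0 : 0 <= (A * G 1%g 1%g) ^+ 2 by exact: sqr_ge0.
(* For small [n], Harnack's inequality bounds both kernels, and [s ^+ c <= s ^+ n] since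
   [n <= c]. *)
case: (leqP ((len g).+1 + h) n) => hn; last first.
  have K1 z : 0 <= G g z / G 1%g z <= (e ^+ len g)^-1.
    rewrite divr_ge0 ?(ltW (g0 _ _)) //= ler_pdivrMr // ler_pdivlMl //.
    by have := green_harnackl geod tw harnack 1%g g z; rewrite dist1.
  have Kd : `|G g x / G 1%g x - G g y / G 1%g y| <= B.
    apply: (@le_trans _ _ (e ^+ len g)^-1); last first.
      by rewrite /B -[leLHS]mul1r ler_wpM2r ?invr_ge0 ?(ltW eg) // lerDr.
    exact: abs_diff_le.
  apply: ler_pM => //; first exact: ltW.
  rewrite ler_wiXn2l ?(ltW s0) ?(ltW s1) //; apply: leq_trans (ltnW hn) _.
  by rewrite /c leq_add2l leq_pmull.
(* The first gap only gives the initial bound on the ratio, hence [k = q - 1]; this gap, the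
   remainder of the division and [(len g).+1] are absorbed by [c]. *)
pose q := ((n - (len g).+1) %/ h)%N; pose k := q.-1.
have gn : ((len g).+1 + h <= n)%N by [].
have q0 : (0 < q)%N by rewrite divn_gt0 // leq_subRL ?(leq_trans _ gn) ?leq_addr.
have kq : k.+1 = q by rewrite prednK.
have qn : (q * h <= n - (len g).+1)%N by exact: leq_divM.
have nq : (n - (len g).+1 < q.+1 * h)%N by rewrite -ltn_divLR.
have Hk : (d y x + 2 * (k.+1 * h + (len g).+1) <= len y + len x)%N.
  apply: leq_trans Hn; rewrite leq_add2l leq_mul2l kq /=.
  by rewrite addnC -leq_subRL // (leq_trans _ gn) ?leq_addr.
have := martin_difference A1 N0 anc tail Hk; rewrite -/eta => md.
have sk : (1 - eta) ^+ k <= s ^+ (h * k).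
  by rewrite exprM lerXn2r // nnegrE ?exprn_ge0 ?(ltW s0) //; lra.
have skn : s ^+ (h * k) * s ^+ c <= s ^+ n.
  rewrite -exprD ler_wiXn2l ?(ltW s0) ?(ltW s1) // /c.
  move: nq; rewrite -kq !mulSn [(h * k)%N]mulnC.
  by move: (k * h)%N (len g) => i j; clear; lia.
apply: le_trans (ler_wpM2r (ltW sc) md) _.
rewrite mulrAC [leLHS]mulrC; apply: ler_pM.
- by rewrite divr_ge0 // ltW.
- by rewrite mulr_ge0 ?exprn_ge0 ?(ltW s0) //; lra.
- by rewrite /B ler_wpM2r ?invr_ge0 ?(ltW eg) // lerDl.
- by apply: le_trans skn; rewrite ler_wpM2r ?(ltW sc).
Qed.

End Holder.

(** * Comparison of two word metrics *)

Section CompareLengths.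
Variables (Gamma : groupType) (len len2 : Gamma -> nat) (D Q : nat).
Hypothesis geod : geodesic_length len.
Hypothesis hyp : four_point len D.
Hypothesis geod2 : geodesic_length len2.
Hypothesis lenQ : forall x, (len x <= Q * len2 x)%N.
Hypothesis len2Q : forall x, (len2 x <= Q * len x)%N.
Hypothesis Q0 : (0 < Q)%N.
Local Notation d := (dist len).
Local Notation d2 := (dist len2).
Local Open Scope nat_scope.

Lemma geodesic_path x y : exists v : nat -> Gamma,
  [/\ v 0 = x, v (d2 x y) = y &
      forall i j, i <= j <= d2 x y -> d2 (v i) (v j) = j - i].
Proof.
suff [v [v0 vl step]] : exists v : nat -> Gamma, [/\ v 0 = x, v (d2 x y) = y &
    forall i, i < d2 x y -> d2 (v i) (v i.+1) = 1].
  have le i k : i + k <= d2 x y -> d2 (v i) (v (i + k)) <= k.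
    elim: k => [|k IHk] ik; first by rewrite addn0 distxx.
    apply: leq_trans (dist_triangle geod2 (v (i + k)) _ _) _.
    by rewrite addnS step ?addn1 ?ltnS ?IHk //; rewrite addnS in ik; rewrite // ltnW.
  exists v; split=> // i j /andP[ij jl].
  have h1 := le 0 i; have h2 := le i (j - i); have h3 := le j (d2 x y - j).
  rewrite add0n v0 in h1; rewrite subnKC // in h2; rewrite subnKC // vl in h3.
  have t1 := dist_triangle geod2 (v i) x y; have t2 := dist_triangle geod2 (v j) (v i) y.
  move: h1 h2 h3 t1 t2 ij jl.
  move: (d2 x y) (d2 x (v i)) (d2 (v i) (v j)) (d2 (v j) y) (d2 (v i) y) => a b c e f.
  by clear; lia.
have [l xl] : exists l, d2 x y = l by exists (d2 x y).
rewrite xl; elim: l x xl => [|l IHl] x xl.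
  exists (fun=> x); split=> //.
  by apply: (mulgI x^-1%g); rewrite mulVg; apply/esym/(geod_eq0 geod2).
have [|z [xz zy]] := geodesic_point geod2 (x := x) (y := y) (k := 1); first by rewrite xl.
have [|v [v0 vl step]] := IHl z; first by rewrite zy xl subn1.
exists (fun i => if i is i'.+1 then v i' else x); split=> //.
by case=> [_|i il]; [rewrite v0 xz|exact: step].
Qed.

Section PathGap.
Variables (v : nat -> Gamma) (l : nat).
Hypothesis v_geod : forall i j, i <= j <= l -> d2 (v i) (v j) = j - i.

Definition morse_const := D.+1 * (36 * Q * D.+1).+2 + 2 * D + 2 * Q.

(** Since [J * D <= M], the first alternative bounds [M] directly; in the second an exponential in
    [M] is below a multiple of [M]. *)
Lemma morse_const_bound M J : M = D.+1 * J + M %% D.+1 -> J = M %/ D.+1 ->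
  2 * M <= 2 * D + J * D + 2 * Q \/ 2 ^ J < 6 * Q * M -> M < morse_const.
Proof.
move=> MJ JE H; rewrite ltnNge; apply/negP; rewrite /morse_const => big.
have mM : M %% D.+1 <= D by rewrite -ltnS ltn_mod.
have DJ : J * D <= M by rewrite MJ; apply: leq_trans (leq_addr _ _); nia.
have JQ : (36 * Q * D.+1).+1 <= J.
  by rewrite JE leq_divRL //; apply: leq_trans big; nia.
case: H => [|]; first by move: big; nia.
rewrite ltnNge => /negP; apply.
have := @exp2_ge_affine (6 * Q * D.+1) (6 * Q * D.+1) J.
move=> /(_ ltac:(nia)); apply: leq_trans.
by rewrite {1}MJ; nia.
Qed.

(** The piece of the [d2]-geodesic from [v i] to [v j] has at most [6 * Q * M] steps. If this is at
    most [2 ^ J], bisection finds on it a point close to [q], which contradicts [avoid] for large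
    [M]. *)
Lemma path_gap_bound q M i j : i <= j <= l ->
  (forall k, k <= l -> M <= d q (v k)) ->
  d q (v i) + d q (v j) <= d (v i) (v j) + 2 * D -> d (v i) (v j) <= 6 * M ->
  M < morse_const.
Proof.
move=> /andP[ij jl] avoid prod len6.
apply: (morse_const_bound (J := M %/ D.+1)) => //.
  by rewrite mulnC {1}(divn_eq M D.+1).
case: (leqP (6 * Q * M) (2 ^ (M %/ D.+1))) => small; last by right.
left; have step k : i <= k < i + (j - i) -> d (v k) (v k.+1) <= Q.
  move=> /andP[ik kj]; have := lenQ ((v k)^-1 * v k.+1)%g.
  have e1 : d2 (v k) (v k.+1) = 1.
    by rewrite v_geod ?subSnn // leqnSn /=; lia.
  by rewrite -/(d2 _ _) e1 muln1.
have jiQ : j - i <= 2 ^ (M %/ D.+1).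
  apply: leq_trans small; rewrite -v_geod ?ij //.
  apply: leq_trans (len2Q _) _; rewrite [6 * Q]mulnC -mulnA leq_mul2l.
  by apply/orP; right.
have [k ik H] := path_near_product geod hyp q jiQ step.
rewrite subnKC // in H ik; have kl : k <= l by lia.
have := avoid k kl; move: H; rewrite !(distC geod _ q) => H avk.
by move: H avk prod; move: (_ %/ _) => J; clear; nia.
Qed.

End PathGap.

(** A geodesic passes through [q] between [y1] and [y2]. Each of them is either the given point or
    at distance [2 * M], far enough for replacing it by a point within [M] to cost only [D]. *)
Lemma anchored_product q y1 y2 a b M :
  d q y1 + d q y2 = d y1 y2 -> D < M -> M <= d q a -> M <= d q b ->
  (a = y1 \/ d q y1 = 2 * M /\ d y1 a <= M) ->
  (b = y2 \/ d q y2 = 2 * M /\ d y2 b <= M) ->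
  d q a + d q b <= d a b + 2 * D.
Proof.
move=> y12 DM Ma Mb aP bP; have sym := distC geod.
have ay2 : d q a + d q y2 <= d a y2 + D.
  case: aP => [->|[qy1 y1a]]; first by rewrite y12 leq_addr.
  by case: (four_pointP hyp y1 a y2 q) => H;
    rewrite ?(sym y1 q) ?(sym y2 q) ?(sym a q) in H *; lia.
case: bP => [->|[qy2 y2b]]; first by apply: leq_trans ay2 _; lia.
by case: (four_pointP hyp a b y2 q) => H;
  rewrite ?(sym y2 q) ?(sym a q) ?(sym b q) ?(sym b y2) in H *; lia.
Qed.

Lemma anchor (v : nat -> Gamma) l q z M :
  (exists2 i, i <= l & v i = z) ->
  (forall q', d q q' + d q' z = d q z -> exists2 i, i <= l & d q' (v i) <= M) ->
  exists y1 i, [/\ i <= l, d q y1 + d y1 z = d q z, d q y1 <= 2 * M &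
    v i = y1 \/ d q y1 = 2 * M /\ d y1 (v i) <= M].
Proof.
move=> [i il vi] near; case: (leqP (d q z) (2 * M)) => [qz|qz].
  by exists z, i; rewrite distxx // addn0; split=> //; left.
have [|y1 [qy1 y1z]] := geodesic_point geod (x := q) (y := z) (k := 2 * M); first exact: ltnW.
have [|j jl y1j] := near y1; first by rewrite qy1 y1z subnKC // ltnW.
by exists y1, j; split; rewrite ?qy1 ?y1z ?subnKC // ?(ltnW qz) //; right.
Qed.

(** Morse lemma. For the least [M] such that all geodesic points are within [M] of the path, some
    [p] has distance at least [M] from it. Going at most [2 * M] to both sides of [p], then at most
    [M] to the path, isolates a piece with ends at most [6 * M] apart, to which [path_gap_bound]
    applies. *)
Lemma geodesic_near_path (v : nat -> Gamma) l x y q :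
  v 0 = x -> v l = y -> (forall i j, i <= j <= l -> d2 (v i) (v j) = j - i) ->
  d x q + d q y = d x y -> exists2 i, i <= l & d q (v i) <= morse_const.
Proof.
move=> v0 vl v_geod xqy; have tri := dist_triangle geod; have sym := distC geod.
pose near q' M := exists2 i, i <= l & d q' (v i) <= M.
pose all_near M := forall q', d x q' + d q' y = d x y -> near q' M.
have exM : exists M, `[< all_near M >].
  exists (d x y); apply/asboolP => q' q'P; exists 0 => //.
  by rewrite v0 -q'P sym leq_addr.
case: (ex_minnP exM) => M /asboolP allM minM.
suff Mc : M <= morse_const.
  by have [i il qi] := allM q xqy; exists i => //; exact: leq_trans Mc.
case: M allM minM => [//|M0] allM minM; set M := M0.+1 in allM minM *.
have [p pP far] : exists2 p, d x p + d p y = d x y & ~ near p M0.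
  apply: contrapT => none; suff : M <= M0 by rewrite /M ltnn.
  apply: minM; apply/asboolP => p pP; apply: contrapT => far.
  by apply: none; exists p.
have farM k : k <= l -> M <= d p (v k).
  by move=> kl; rewrite /M ltnNge; apply/negP => le; apply: far; exists k.
have between_x q' : d p q' + d q' x = d p x -> d x q' + d q' y = d x y.
  have := tri p q' y; have := tri q' x y; move: pP.
  rewrite (sym x p) (sym x q') (sym q' p).
  by move: (d p x) (d p y) (d x y) (d p q') (d q' x) (d q' y) => *; lia.
have between_y q' : d p q' + d q' y = d p y -> d x q' + d q' y = d x y.
  have := tri p x q'; have := tri q' x y; move: pP.
  by move: (d x p) (d p y) (d x y) (d p q') (d x q') (d q' y) => *; lia.
have [||y1 [i [il py1 y1M iP]]] := @anchor v l p x M.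
- by exists 0.
- by move=> q' /between_x /allM.
have [||y2 [j [jl py2 y2M jP]]] := @anchor v l p y M.
- by exists l.
- by move=> q' /between_y /allM.
have y12 : d p y1 + d p y2 = d y1 y2.
  have := tri y1 x y; have := tri y2 y1 y; have := tri p y1 y2.
  move: pP py1 py2; rewrite (sym x p) (sym x y1) (sym y1 p).
  move: (d p x) (d p y) (d x y) (d p y1) (d p y2) (d y1 x) (d y2 y) (d y1 y2) (d y1 y).
  by clear; lia.
apply: ltnW; case: (leqP M D) => [MD|DM].
  by apply: leq_ltn_trans MD _; rewrite /morse_const; lia.
have prod := anchored_product y12 DM (farM i il) (farM j jl) iP jP.
have d6 : d (v i) (v j) <= 6 * M.
  have h1 : d y1 (v i) <= M by case: iP => [->|[]] //; rewrite distxx.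
  have h2 : d y2 (v j) <= M by case: jP => [->|[]] //; rewrite distxx.
  have := tri y1 (v i) (v j); have := tri y2 y1 (v j).
  move: h1 h2 y1M y2M y12; rewrite (sym (v i) y1).
  move: (d y1 (v i)) (d y2 (v j)) (d p y1) (d p y2) (d y1 y2) (d (v i) (v j)) (d y1 (v j)).
  by clear; lia.
case: (leqP i j) => ij.
  by apply: (path_gap_bound (v := v) (l := l) v_geod (q := p) (i := i) (j := j)); rewrite ?ij.
apply: (path_gap_bound (v := v) (l := l) v_geod (q := p) (i := j) (j := i)) => //.
- by rewrite il ltnW.
- by rewrite addnC (sym (v j)).
- by rewrite (sym (v j)).
Qed.

(** The Gromov product is, up to a constant, the length of a suitable point [q] on a geodesic from
    [x] to [y]. A [d2]-geodesic passes near [q], and all its points have [len2] at least [n]. The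
    subtraction of [K] is truncated at [0]. *)
Lemma product_comparison : exists K, forall x y n,
  d2 x y + 2 * n <= len2 x + len2 y ->
  d x y + 2 * (n %/ Q - K) <= len x + len y.
Proof.
exists (morse_const + D).+1 => x y n xyn; have tri := dist_triangle geod.
have d1 := dist1 len.
have [v [v0 vl v_geod]] := geodesic_path x y.
have tx := tri 1%g x y; have ty := tri x 1%g y; have txy := tri y 1%g x.
rewrite !d1 ?(distC geod _ 1%g) ?d1 ?(distC geod y x) in tx ty txy.
(* The Gromov product of [1] and [y] based at [x], rounded down: at this distance from [x] the
   geodesics to [1] and to [y] separate. *)
pose k := (len x + d x y - len y)./2.
have k2 : 2 * k <= len x + d x y - len y <= 2 * k + 1.
  by rewrite /k -{2 3}(odd_double_half (len x + d x y - len y)) -mul2n; case: odd; lia.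
have [|q [xq qy]] := geodesic_point geod (x := x) (y := y) (k := k); first by lia.
have [|i il qi] := geodesic_near_path (q := q) v0 vl v_geod.
  by rewrite xq qy subnKC //; lia.
have q4 : 2 * len q + d x y <= len x + len y + 2 * D + 1.
  have := four_pointP hyp 1%g x q y; rewrite !d1 xq qy.
  move: k2 tx ty txy {xq qy}; clearbody k.
  by move: (len q) (len x) (len y) (d x y) k => a b c e k'; clear; lia.
have nv : n <= len2 (v i).
  have hx : d2 x (v i) = i by rewrite -{1}v0 v_geod // subn0.
  have hy : d2 (v i) y = d2 x y - i by rewrite -{1}vl v_geod // il leqnn.
  have := dist_triangle geod2 (v i) 1%g x; have := dist_triangle geod2 (v i) 1%g y.
  rewrite !dist1 (distC geod2 (v i) x) hx hy; move: xyn il.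
  move: (len2 (v i)) (len2 x) (len2 y) (d2 x y) => a b c e.
  by clear; lia.
have nq : n %/ Q <= len q + morse_const.
  rewrite -[leqRHS](mulKn _ Q0); apply: leq_div2r; apply: leq_trans nv _.
  apply: leq_trans (len2Q _) _; rewrite leq_mul2l; apply/orP; right.
  by have := tri q 1%g (v i); rewrite !d1 => /leq_trans; apply; rewrite leq_add2l.
move: q4 nq tx; move: (n %/ Q) (len q) (len x) (len y) (d x y) morse_const.
by clear; lia.
Qed.

End CompareLengths.

Lemma word_length_bound (Gamma : groupType) (S : set Gamma) (len : Gamma -> nat) :
  symmetric_generating_set S -> geodesic_length len ->
  exists Q, forall x, (len x <= Q * word_length S x)%N.
Proof.
move=> S_gen geod; have [/finite_seqP[L SL] _ _] := S_gen.
exists (\max_(s <- L) len s)%N => x.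
have [[u [<- Su <-]] _] := word_lengthP S_gen x.
elim: u Su => [|s u IHu] Su; first by rewrite big_nil (geod_len1 geod).
rewrite big_cons mulnS; apply: leq_trans (geod_lenM geod _ _) _; apply: leq_add.
  have : S s by apply: Su; rewrite mem_head.
  by rewrite SL => sL; exact: leq_bigmax_seq.
by apply: IHu => t tu; apply: Su; rewrite inE tu orbT.
Qed.

Lemma finite_walk_support (R : realType) (Gamma : groupType) (mu : Gamma -> R) :
  finitely_supported_probability mu -> exists ms, finite_walk mu ms.
Proof.
move=> [mu0 /finite_seqP[L suppL] mu1]; exists (undup L).
have out s : s \notin undup L -> mu s = 0.
  rewrite mem_undup => sL; apply/eqP/negPn/negP => mus.
  by move/negP: sL; apply; have : walk_support mu s by []; rewrite suppL.
split=> //; first exact: undup_uniq.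
by rewrite -[RHS]mu1 -/(gsum mu); apply/esym/gsumE => //; exact: undup_uniq.
Qed.

Lemma nonelementary_hyperbolic_walk (R : realType) (Gamma : groupType)
    (mu : Gamma -> R) (S : set Gamma) :
  symmetric_generating_set S -> gromov_hyperbolic R S -> nonelementary Gamma ->
  finitely_supported_probability mu -> nondegenerate_walk mu ->
  exists D ms r C lam e,
    hyperbolic_walk (word_length S) D mu ms r C lam e.
Proof.
move=> S_gen S_hyp nonel prob nondeg; have geod := word_length_geodesic S_gen.
have [D hyp] := word_length_four_point S_gen S_hyp.
have [ms walk] := finite_walk_support prob.
have [L branching] := nonelementary_branching geod hyp nonel.
have [K K0 KP] := poincare walk nondeg branching
  (outward_multiplicity geod hyp L).
have [C [lam [C0 lam01 decay]]] := nstep_decay walk K0 KP.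
have tw : transient_walk (word_length S) mu ms C lam by split.
have [e e01 harnack] := nstep_harnack geod tw.
exists D, ms, (\max_(s <- ms) word_length S s)%N, C, lam, e; split=> // s sms.
exact: leq_bigmax_seq.
Qed.

(** The walk is studied in the word metric of the generating set [S'] given by hyperbolicity;
    [product_comparison] transfers the estimate to [S]. *)
Theorem martin_holder (R : realType) (Gamma : groupType) (mu : Gamma -> R)
    (S : set Gamma) : hyperbolic_group R Gamma -> nonelementary Gamma ->
  finitely_supported_probability mu -> nondegenerate_walk mu ->
  symmetric_generating_set S ->
  exists2 s : R, 0 < s < 1 &
  forall g, exists2 H : R, 0 <= H & forall x y n,
    (word_dist S x y + 2 * n <= word_length S x + word_length S y)%N ->
    `|martin mu g x - martin mu g y| <= H * s ^+ n.
Proof.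
move=> [S' S'_gen S'_hyp] nonel prob nondeg S_gen.
have [D [ms [r [C [lam [e hw]]]]]] :=
  nonelementary_hyperbolic_walk S'_gen S'_hyp nonel prob nondeg.
have geod := hw_geod hw; have geod2 := word_length_geodesic S_gen.
have [Q1 Q1P] := word_length_bound S_gen geod.
have [Q2 Q2P] := word_length_bound S'_gen geod2.
pose Q := (Q1 + Q2).+1.
have lenQ x : (word_length S' x <= Q * word_length S x)%N.
  by apply: leq_trans (Q1P x) _; rewrite leq_mul2r /Q -addnS leq_addr orbT.
have len2Q x : (word_length S x <= Q * word_length S' x)%N.
  by apply: leq_trans (Q2P x) _; rewrite leq_mul2r /Q -addSn leq_addl orbT.
have [K KP] := product_comparison geod (hw_hyp hw) geod2 lenQ len2Q (ltn0Sn _).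
have [s /andP[s0 s1] sP] := martin_holder_nat hw.
have [|t /andP[t0 t1] st] := @exists_root_ge R s Q _ (ltn0Sn _); first by rewrite s0.
exists t => [|g]; first by rewrite t0.
have [H H0 HP] := sP g.
(* [s ^+ K] pays for the subtracted [K], and [t ^+ Q] for the remainder in the division of [n] by
   [Q]. *)
exists (H / s ^+ K / t ^+ Q) => [|x y n xyn].
  by rewrite !divr_ge0 // exprn_ge0 // ltW.
have xy' := KP x y n xyn; rewrite addnC (distC geod) [X in (_ <= X)%N]addnC in xy'.
rewrite addnC in xy'; apply: le_trans (HP x y _ xy') _.
have sK : 0 < s ^+ K by rewrite exprn_gt0.
have tQ : 0 < t ^+ Q by rewrite exprn_gt0.
suff : s ^+ (n %/ Q - K) * (s ^+ K * t ^+ Q) <= t ^+ n.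
  rewrite -ler_pdivlMr ?mulr_gt0 // => /(ler_wpM2l H0) h; apply: le_trans h _.
  suff -> : H * (t ^+ n / (s ^+ K * t ^+ Q)) = H / s ^+ K / t ^+ Q * t ^+ n by [].
  by field; rewrite !gt_eqF.
rewrite mulrA -exprD; apply: (@le_trans _ _ (t ^+ (Q * (n %/ Q)) * t ^+ Q)); last first.
  rewrite -exprD ler_wiXn2l ?(ltW t0) ?(ltW t1) //.
  by rewrite mulnC -mulSnr ltnW // ltn_ceil.
rewrite ler_wpM2r ?(ltW tQ) // exprM.
apply: (@le_trans _ _ (s ^+ (n %/ Q))).
  rewrite ler_wiXn2l ?(ltW s0) ?(ltW s1) //.
  by move: (n %/ Q)%N => m; clear; lia.
by rewrite lerXn2r // nnegrE ?exprn_ge0 // ltW.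
Qed.

(** * Boundary values *)

Section BoundaryExtension.
Variables (R : realType) (Gamma : groupType) (S : set Gamma).
Hypothesis S_gen : symmetric_generating_set S.
Variables (K : Gamma -> R) (s H : R).
Hypothesis s01 : 0 < s < 1.
Hypothesis H0 : 0 <= H.
Hypothesis K_holder : forall x y n,
  (word_dist S x y + 2 * n <= word_length S x + word_length S y)%N ->
  `|K x - K y| <= H * s ^+ n.
Implicit Types (xi eta : gromov_boundary R S) (u v : nat -> Gamma).
Local Notation gp := (gromov_product R S).

Let s0 : 0 < s. Proof. by case/andP: s01. Qed.
Let s1 : s < 1. Proof. by case/andP: s01. Qed.

Lemma gromov_product_ge0 x y : 0 <= gp x y.
Proof.
have geod := word_length_geodesic S_gen.
rewrite divr_ge0 // subr_ge0 -natrD ler_nat.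
by have := dist_triangle geod 1%g x y; rewrite (distC geod x 1%g) !dist1.
Qed.

Lemma holder_nat x y n : n%:R <= gp x y -> `|K x - K y| <= H * s ^+ n.
Proof.
move=> ngp; apply: K_holder; rewrite -(ler_nat R) natrD natrM natrD.
by move: ngp; rewrite /gromov_product ler_pdivlMr //; lra.
Qed.

(** Rounding the Gromov product down to an integer costs one factor [s^-1]. *)
Lemma holder_real x y (t : R) : t <= gp x y -> `|K x - K y| <= H / s * s `^ t.
Proof.
move=> tgp; set n := Num.truncn (gp x y).
have /andP[n1 n2] := truncn_itv (gromov_product_ge0 x y).
apply: le_trans (holder_nat n1) _; rewrite -mulrA ler_wpM2l // ler_pdivlMl //.
rewrite -exprS -powR_mulrn ?(ltW s0) //; apply: ger_powR; first by rewrite s0 ltW.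
exact: le_trans tgp (ltW n2).
Qed.

Lemma filter_prod_nat (A : set (nat * nat)) : filter_prod \oo \oo A ->
  exists N, forall i j, (N <= i)%N -> (N <= j)%N -> A (i, j).
Proof.
move=> [[P Q] /= [[n _ Pn] [m _ Qm]] PQ].
exists (maxn n m) => i j; rewrite !geq_max => /andP[ni _] /andP[_ mj].
by apply: PQ; split; [exact: Pn|exact: Qm].
Qed.

Lemma equiv_close u v (eps : R) : gromov_equiv R S u v -> 0 < eps ->
  exists N, forall i j, (N <= i)%N -> (N <= j)%N -> `|K (u i) - K (v j)| < eps.
Proof.
move=> uv eps0; have A0 : 0 < (H + 1) / eps by rewrite divr_gt0 // ltr_wpDl.
have [n nP] := exp_small s01 A0.
have /filter_prod_nat[N NP] :
    filter_prod \oo \oo [set ij : nat * nat | n%:R < gp (u ij.1) (v ij.2)].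
  apply: (uv [set t | n%:R < t]); exact: nbhs_pinfty_gt.
exists N => i j Ni Nj; apply: le_lt_trans (holder_nat (ltW (NP i j Ni Nj))) _ => /=.
have := nP n (leqnn n); rewrite mulrA ler_pdivrMr // mul1r => h.
by apply: lt_le_trans h; rewrite mulrC ltr_pM2l ?exprn_gt0 // ltrDl.
Qed.

Lemma toward_proper xi : ProperFilter (toward xi).
Proof.
have [u cu xiE] := boundary_classP xi.
have uxi : converges_to u xi by rewrite /converges_to xiE.
split; first by move=> /(_ u uxi) [N _ /(_ N (leqnn N))].
split=> [v _|A B tA tB v vxi|A B AB tA v vxi]; first exact: filterT.
  by apply: filterI; [exact: tA|exact: tB].
by apply: filterS (tA v vxi) => n; exact: AB.
Qed.

(** This excludes the default value of [lim]. Along every sequence towards [xi] the values are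
    eventually close to [K (u N)] for one fixed representative [u], which is a Cauchy criterion. *)
Lemma cvg_toward xi : K y @[y --> toward xi] --> lim (K y @[y --> toward xi]).
Proof.
have PF := toward_proper xi; apply/cauchy_cvgP; apply: cauchy_exP => eps eps0.
have [u cu xiE] := boundary_classP xi.
have e2 : 0 < eps / 2 by rewrite divr_gt0.
have [N NP] := equiv_close cu e2.
exists (K (u N)) => v; rewrite /converges_to xiE => -[_ uv].
have [M MP] := equiv_close uv e2.
exists M => // n /= Mn; rewrite /ball /=.
have h1 := NP N (maxn N M) (leqnn _) (leq_maxl _ _).
have h2 := MP (maxn N M) n (leq_maxr _ _) Mn.
by have := ler_distD (K (u (maxn N M))) (K (u N)) (K (v n)); lra.
Qed.

Lemma cvg_boundary xi u : converges_to u xi ->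
  K (u n) @[n --> \oo] --> lim (K y @[y --> toward xi]).
Proof. by move=> uxi A /(cvg_toward (xi := xi)) /(_ u uxi). Qed.

(** Some pair of sequences has lower limit above [t]; along its diagonal [holder_real] eventually
    applies, and the bound passes to the limit. *)
Lemma boundary_holder xi eta (t : R) : (t%:E < boundary_product xi eta)%E ->
  `|lim (K y @[y --> toward xi]) - lim (K y @[y --> toward eta])| <= H / s * s `^ t.
Proof.
move=> /ereal_sup_gt[_ [[u v] [/= uxi veta] <-]].
rewrite limf_einfE => /ereal_sup_gt[_ [V FV <-]] tV.
have [N NP] := filter_prod_nat FV.
have cu := cvg_boundary uxi; have cv := cvg_boundary veta.
have cn : `|K (u n) - K (v n)| @[n --> \oo] -->
    `|lim (K y @[y --> toward xi]) - lim (K y @[y --> toward eta])|.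
  by apply: cvg_norm; exact: cvgB.
rewrite -(cvg_lim _ cn) //; apply: limr_le.
  by apply/cvg_ex; eexists; exact: cn.
exists N => // n /= Nn; apply: holder_real.
have : (t%:E <= (gp (u n) (v n))%:E)%E.
  apply: ltW; apply: lt_le_trans tV _; apply: ereal_inf_lbound.
  by exists (n, n) => //; exact: NP.
by rewrite lee_fin.
Qed.

(** This rules out the value [-oo], at which [power_ereal] would be [0]. *)
Lemma boundary_product_ge0 xi eta : (0 <= boundary_product xi eta)%E.
Proof.
have [u cu xiE] := boundary_classP xi; have [v cv etaE] := boundary_classP eta.
apply: (@le_trans _ _ (limf_einf (fun ij : nat * nat =>
  (gp (u ij.1) (v ij.2))%:E) (filter_prod \oo \oo))); last first.
  by apply: ereal_sup_ubound; exists (u, v) => //; rewrite xiE etaE.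
rewrite limf_einfE; apply: (@le_trans _ _ (ereal_inf [set (gp (u ij.1) (v ij.2))%:E
   | ij in [set: nat * nat]])).
  by apply: le_ereal_inf_tmp => _ [ij _ <-]; rewrite lee_fin gromov_product_ge0.
by apply: ereal_sup_ubound; exists setT => //; exact: filterT.
Qed.

Lemma boundary_holder_power xi eta :
  `|lim (K y @[y --> toward xi]) - lim (K y @[y --> toward eta])|
    <= H / s / s * power_ereal s (boundary_product xi eta).
Proof.
have := boundary_product_ge0 xi eta; have := @boundary_holder xi eta.
case: boundary_product => [t|bound _|//] /=.
  (* A strict inequality is required, hence [t - 1] and a second factor [s^-1]. *)
  move=> bound _; apply: le_trans (bound (t - 1) _) _.
    by rewrite lte_fin gtrBl.
  rewrite powRB ?(gt_eqF s0) ?implybT // powRr1 ?(ltW s0) //.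
  suff -> : H / s * (s `^ t / s) = H / s / s * s `^ t by [].
  by ring.
(* An infinite product allows every exponent [n], and [c <= H / s * s ^+ n] for all [n] forces
   [c <= 0]. *)
rewrite mulr0; set c := `|_|; case: (lerP c 0) => // c0.
have A0 : 0 < (H / s + 1) / c.
  by rewrite divr_gt0 // ltr_wpDl // divr_ge0 // ltW.
have [n nP] := exp_small s01 A0; have := nP n (leqnn n).
rewrite mulrA ler_pdivrMr // mul1r => h.
have := bound n%:R (ltry _); rewrite powR_mulrn ?(ltW s0) // -/c => h'.
have : 0 < s ^+ n by rewrite exprn_gt0.
by lra.
Qed.

End BoundaryExtension.

Theorem theorem3p3 (R : realType) (Gamma : groupType) (mu : Gamma -> R)
    (S : set Gamma)
    (Gamma_hyperbolic : hyperbolic_group R Gamma)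
    (Gamma_nonelementary : nonelementary Gamma)
    (mu_probability : finitely_supported_probability mu)
    (mu_nondegenerate : nondegenerate_walk mu)
    (S_generating : symmetric_generating_set S)
    (supp_mu_sub_S : walk_support mu `<=` S) :
  exists tau : R, (0 <= tau < 1) /\
    forall g : Gamma, exists2 H : R, 0 <= H &
      forall xi eta : gromov_boundary R S,
        `|boundary_martin mu g xi - boundary_martin mu g eta|
          <= H * power_ereal tau (boundary_product xi eta).
Proof.
have [s s01 sP] := martin_holder Gamma_hyperbolic Gamma_nonelementary
  mu_probability mu_nondegenerate S_generating.
have /andP[s0 s1] := s01; exists s; split; first by rewrite ltW.
move=> g; have [H H0 HP] := sP g.
exists (H / s / s) => [|xi eta]; first by rewrite !divr_ge0 // ltW.
exact: boundary_holder_power.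
Qed.
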